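(* Let $B\ge1$ be an integer and let $f:SO(3)\to\mathbb{R}$ be a band-limited function with bandwidth $B$, that is, $$f(R)=\sum_{l=0}^{\infty}\sum_{m,n=-l}^{l}(2l+1)F^l_{m,n}U^l_{m,n}(R)$$ with real Fourier parameters $F^l_{m,n}$ satisfying $F^l_{m,n}=0$ for all $l\ge B$. Define the grid $$\alpha_j=\gamma_j=\frac{\pi}{B}j,\qquad \beta_k=\frac{\pi(2k+1)}{4B},\qquad j,k\in\{0,\dots,2B-1\}.$$ Then the Fourier parameters of $f$ are given, for $0\le l\le B-1$ and $-l\le m,n\le l$, by $$F^l_{m,n}=\sum_{j_1,j_2,k=0}^{2B-1}w_k\,U^l_{m,n}\big(R(\alpha_{j_1},\beta_k,\gamma_{j_2})\big)\,f\big(R(\alpha_{j_1},\beta_k,\gamma_{j_2})\big),$$ where $$w_k=\frac{1}{4B^3}\sin\beta_k\sum_{j=0}^{B-1}\frac{1}{2j+1}\sin\big((2j+1)\beta_k\big).$$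
   Context: All $(2l+1)\times(2l+1)$ matrices have rows and columns indexed by $m,n\in\{-l,\dots,l\}$ in ascending order. Euler angles: for $x\in\mathbb{R}^3$, $\hat x$ is the skew-symmetric matrix with $\hat x y=x\times y$; $e_1,e_2,e_3$ is the standard basis; $R(\alpha,\beta,\gamma)=\exp(\alpha\hat e_3)\exp(\beta\hat e_2)\exp(\gamma\hat e_3)$, with $\alpha,\gamma\in[0,2\pi)$, $\beta\in[0,\pi]$. Wigner matrices: $D^l:SO(3)\to\mathbb{C}^{(2l+1)\times(2l+1)}$ is the irreducible unitary representation $D^l_{m,n}(R(\alpha,\beta,\gamma))=e^{-im\alpha}d^l_{m,n}(\beta)e^{-in\gamma}$, where $d^l(\beta)$ is the real Wigner d-matrix; with the paper's convention $d^l(\beta)=\exp(\beta A^l)$, $A^l_{m,n}=-\tfrac12\sqrt{(l+m)(l-m+1)}\,\delta_{m-1,n}+\tfrac12\sqrt{(l-m)(l+m+1)}\,\delta_{m+1,n}$ (the standard Wigner d-matrix). Real harmonics: $U^l(R)=\overline{T^l}\,D^l(R)\,(T^l)^T$, which is a real matrix, where the unitary matrix $T^l$ is $$T^l_{m,n}=\begin{cases}1&m=n=0,\\0&|m|\ne|n|,\\ (-1)^m/\sqrt2&m>0,\ n=m,\\ 1/\sqrt2&m>0,\ n=-m,\\ i/\sqrt2&m<0,\ n=m,\\ -i(-1)^m/\sqrt2&m<0,\ n=-m.\end{cases}$$ The Fourier parameters are equivalently $F^l_{m,n}=\int_{SO(3)}U^l_{m,n}(R)f(R)\,dR$, with $dR=\frac{1}{8\pi^2}\sin\beta\,d\alpha\,d\beta\,d\gamma$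 the normalized Haar measure; the $U^l_{m,n}$ are orthogonal with $\int_{SO(3)} U^{l_1}_{m_1,n_1}U^{l_2}_{m_2,n_2}dR=\frac{1}{2l_1+1}\delta_{l_1,l_2}\delta_{m_1,m_2}\delta_{n_1,n_2}$. *)

(* Defs.v *)
From HB Require Import structures.
From mathcomp Require Import all_boot all_order all_algebra.
From mathcomp Require Export complex.
From mathcomp Require Import all_classical all_reals all_analysis.
From mathcomp Require Import zify ring lra.

Set Implicit Arguments.
Unset Strict Implicit.
Unset Printing Implicit Defensive.

Import Order.TTheory GRing.Theory Num.Theory.
Import numFieldNormedType.Exports.

Local Open Scope classical_set_scope.
Local Open Scope ring_scope.
Local Open Scope complex_scope.

Section Defs.
Variable R : realType.
Implicit Types (l : nat) (Q : 'M[R]_3).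

(* The limit is taken in the normed space of matrices. *)
Definition mexp n (A : 'M[R]_n.+1) : 'M[R]_n.+1 :=
  limn (series (fun k => (k`!%:R)^-1 *: A ^+ k)).

Definition SO3 : {pred 'M[R]_3} :=
  [pred Q : 'M[R]_3 | (Q^T *m Q == 1%:M) && (\det Q == 1)].

(* Indices of ['I_3] are added modulo 3. *)
Definition cross (x y : 'cV[R]_3) : 'cV[R]_3 :=
  \col_i (x (i + 1) 0 * y (i + 2) 0 - x (i + 2) 0 * y (i + 1) 0).

Definition hat (x : 'cV[R]_3) : 'M[R]_3 :=
  \matrix_(i, j) cross x (delta_mx j 0) i 0.

Definition e2 : 'cV[R]_3 := delta_mx 1 0.
Definition e3 : 'cV[R]_3 := delta_mx 2 0.

Definition euler (a b g : R) : 'M[R]_3 :=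
  mexp (a *: hat e3) *m mexp (b *: hat e2) *m mexp (g *: hat e3).

(* Rows and columns labelled -l, ..., l are stored at positions 0, ..., 2l:
   [lbl i] is the label of position [i]. *)
Definition lbl l (i : 'I_(l.*2.+1)) : int := i%:Z - l%:Z.

Definition wigner_gen l : 'M[R]_(l.*2.+1) :=
  \matrix_(i, j)
    let m := lbl i in let n := lbl j in
    - 2^-1 * Num.sqrt (((l%:Z + m) * (l%:Z - m + 1))%:~R) * (m - 1 == n)%:R
    + 2^-1 * Num.sqrt (((l%:Z - m) * (l%:Z + m + 1))%:~R) * (m + 1 == n)%:R.

Definition wigner_d l (b : R) : 'M[R]_(l.*2.+1) := mexp (b *: wigner_gen l).

Definition expi (t : R) : R[i] := cos t +i* sin t.

Definition wigner_euler l (a b g : R) : 'M[R[i]]_(l.*2.+1) :=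
  \matrix_(i, j) (expi (- ((lbl i)%:~R * a)) * (wigner_d l b i j)%:C
                  * expi (- ((lbl j)%:~R * g))).

Definition euler_angles Q : R * R * R :=
  xget (0, 0, 0) [set t : R * R * R |
    [/\ 0 <= t.1.1 < 2 * pi, 0 <= t.1.2 <= pi, 0 <= t.2 < 2 * pi
      & euler t.1.1 t.1.2 t.2 = Q]].

(* Euler angles are unique except at b = 0 and b = pi, where the triples (a, b, g)
   giving the same rotation also give the same [wigner_euler]: the value does
   not depend on the choice made by [euler_angles]. *)
Definition wigner_D l Q : 'M[R[i]]_(l.*2.+1) :=
  let t := euler_angles Q in wigner_euler l t.1.1 t.1.2 t.2.

Definition real_basis l : 'M[R[i]]_(l.*2.+1) :=
  \matrix_(i, j)
    let m := lbl i in let n := lbl j in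
    let s : R[i] := (Num.sqrt 2)%:C in
    if (m == 0) && (n == 0) then 1
    else if `|m| != `|n| then 0
    else if 0 < m then (if n == m then (-1) ^ m / s else 1 / s)
    else if n == m then 'i / s else - 'i * (-1) ^ m / s.

Definition cplx_harmonic l Q : 'M[R[i]]_(l.*2.+1) :=
  map_mx conjc (real_basis l) *m wigner_D l Q *m (real_basis l)^T.

(* [cplx_harmonic] has real entries, see [cplx_harmonic_real] below. *)
Definition harmonic_U l Q : 'M[R]_(l.*2.+1) :=
  map_mx (@complex.Re R) (cplx_harmonic l Q).

Definition harmonic_expansion (F : forall l, 'M[R]_(l.*2.+1)) (f : 'M[R]_3 -> R) :=
  forall Q, Q \in SO3 ->
    series (fun l => \sum_m \sum_n (l.*2.+1)%:R * F l m n * harmonic_U l Q m n)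
      @ \oo --> f Q.

Definition grid_angle (B j : nat) : R := pi / B%:R * j%:R.
Definition grid_beta (B k : nat) : R := pi * (k.*2.+1)%:R / (4 * B%:R).
Definition grid_weight (B k : nat) : R :=
  1 / (4 * B%:R ^+ 3) * sin (grid_beta B k) *
  \sum_(j < B) 1 / (j.*2.+1)%:R * sin ((j.*2.+1)%:R * grid_beta B k).

Lemma hatE (x y : 'cV[R]_3) : hat x *m y = cross x y.
Proof.
apply/matrixP => i j; rewrite (ord1 j) !mxE.
under eq_bigr do rewrite !mxE !eqxx !andbT.
transitivity (\sum_k (x (i + 1) 0 * ((i + 2 == k)%:R * y k 0)
                      - x (i + 2) 0 * ((i + 1 == k)%:R * y k 0))).
  by apply: eq_bigr => k _; rewrite mulrBl !mulrA.
have sel p : \sum_k ((p == k)%:R * y k 0) = y p 0.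
  rewrite (bigD1 p) //= eqxx mul1r big1 ?addr0 // => k /negbTE kp.
  by rewrite eq_sym kp mul0r.
by rewrite sumrB -!mulr_sumr !sel.
Qed.

Lemma mx_normM n (A B : 'M[R]_n.+1) : `|A * B| <= n.+1%:R * `|A| * `|B|.
Proof.
have le_coef (M : 'M[R]_n.+1) i j : `|M i j| <= `|M|.
  by rewrite [leRHS]/Num.norm/= mx_normrE; apply: (le_bigmax _ _ (i, j)).
rewrite [leLHS]/Num.norm/= mx_normrE; apply/bigmax_leP; split=> [|[i j] _ /=].
  by rewrite !mulr_ge0.
rewrite mxE (le_trans (ler_norm_sum _ _ _))// -mulrA mulr_natl.
rewrite -[X in _ *+ X]card_ord -sumr_const ler_sum// => k _.
by rewrite normrM ler_pM.
Qed.

Lemma is_cvg_mexp n (A : 'M[R]_n.+1) :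
  cvgn (series (fun k => (k`!%:R)^-1 *: A ^+ k)).
Proof.
have norm1 : `|1 : 'M[R]_n.+1| <= 1.
  rewrite [leLHS]/Num.norm/= mx_normrE; apply/bigmax_leP; split=> // -[i j] _ /=.
  by rewrite mxE; case: (i == j); rewrite ?normr1 ?normr0.
have normX k : `|A ^+ k| <= (n.+1%:R * `|A|) ^+ k.
  elim: k => [|k IH]; first by rewrite !expr0.
  by rewrite !exprS (le_trans (mx_normM _ _))// ler_wpM2l// mulr_ge0.
suff: cvgn [normed series (fun k => (k`!%:R)^-1 *: A ^+ k)].
  move=> /cauchy_cvgP/cauchy_seriesP cvgN.
  apply/cauchy_cvgP/cauchy_seriesP => e /cvgN; apply: filterS => p /=.
  by rewrite ger0_norm ?sumr_ge0//; apply: le_lt_trans; exact: ler_norm_sum.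
apply: (series_le_cvg (v_ := exp_coeff (n.+1%:R * `|A|))) => //.
- by move=> k /=.
- by move=> k; apply: exp_coeff_ge0; rewrite mulr_ge0.
- move=> k; rewrite /exp_coeff/= normrZ ger0_norm ?invr_ge0//.
  by rewrite mulrC ler_wpM2r ?invr_ge0.
- exact: is_cvg_series_exp_coeff.
Qed.

Let signsym l (M : 'M[R]_(l.*2.+1)) := forall i j,
  M (rev_ord i) (rev_ord j) = (-1) ^+ (i + j) * M i j.

Let signsym_mexp l (A : 'M[R]_(l.*2.+1)) : signsym A -> signsym (mexp A).
Proof.
move=> sA.
have sX k : signsym (A ^+ k).
  elim: k => [|k IH] i j.
    rewrite expr0 !mxE (inj_eq rev_ord_inj).
    case: eqVneq => [->|_]; last by rewrite mulr0.
    by rewrite addnn -signr_odd odd_double mulr1.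
  rewrite exprS !mxE mulr_sumr (reindex_inj rev_ord_inj); apply: eq_bigr => p _ /=.
  rewrite sA IH mulrACA -exprD; congr (_ * _).
  by rewrite addnA -(addnA i) addnn addnAC exprD -[X in _ * X]signr_odd odd_double mulr1.
have sS k : signsym (series (fun k => (k`!%:R)^-1 *: A ^+ k) k).
  move=> i j; rewrite /series/= !summxE mulr_sumr; apply: eq_bigr => p _.
  by rewrite !mxE sX mulrCA.
move=> i j.
have lim p q : series (fun k => (k`!%:R)^-1 *: A ^+ k) k p q @[k --> \oo] --> mexp A p q.
  apply: (cvg_comp (series (fun k => (k`!%:R)^-1 *: A ^+ k)) (fun M : 'M[R]_(l.*2.+1) => M p q)); first exact: is_cvg_mexp.
  exact: coord_continuous.
have := lim (rev_ord i) (rev_ord j); rewrite (funext (fun k => sS k i j)) => limr.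
apply: (cvg_unique (@norm_hausdorff _ _) limr); apply: cvgM (lim i j); exact: cvg_cst.
Qed.

Let lbl_rev l (i : 'I_(l.*2.+1)) : lbl (rev_ord i) = - lbl i.
Proof. by rewrite /lbl /=; have := ltn_ord i; lia. Qed.

Let signsym_gen l b : signsym (b *: wigner_gen l).
Proof.
move=> i j; rewrite !mxE /= !lbl_rev mulrCA; congr (_ * _).
set m := lbl i; set n := lbl j.
rewrite !opprK (_ : (- m - 1 == - n) = (m + 1 == n)); last by lia.
rewrite (_ : (- m + 1 == - n) = (m - 1 == n)); last by lia.
have [mn|/negbTE mn] := boolP ((m + 1 == n) || (m - 1 == n)); last first.
  by move/norP: (negbT mn) => [/negbTE-> /negbTE->]; rewrite !mulr0 addr0 mulr0.
suff -> : (-1) ^+ (i + j) = -1 :> R by ring.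
have odd_ij : odd (i + j) by move: mn; rewrite /m /n /lbl; lia.
by rewrite -signr_odd odd_ij.
Qed.

Let sg l (i : 'I_(l.*2.+1)) : R[i] := (-1) ^+ odd `|lbl i|.

Let conj_sg l (i : 'I_(l.*2.+1)) : conjc (sg i) = sg i.
Proof. by rewrite /sg rmorphXn rmorphN1. Qed.

Let sg_mul l (i j : 'I_(l.*2.+1)) : sg i * sg j = (-1) ^+ (i + j).
Proof.
rewrite /sg -signr_addb -[RHS]signr_odd; congr (_ ^+ _); congr nat_of_bool.
by rewrite /lbl; lia.
Qed.

Let sg_sqr l (i : 'I_(l.*2.+1)) : sg i * sg i = 1.
Proof. by rewrite sg_mul addnn -signr_odd odd_double. Qed.

Let exprz_m1 (m : int) : (-1) ^ m = (-1) ^+ odd `|m| :> R[i].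
Proof.
case: m => k; first by rewrite -exprnP signr_odd.
by rewrite NegzE -exprz_inv invrN1 -exprnP abszN signr_odd.
Qed.

Let conj_basis l (i j : 'I_(l.*2.+1)) :
  conjc (real_basis l i j) = sg j * real_basis l i (rev_ord j).
Proof.
rewrite !mxE /= lbl_rev /sg !exprz_m1.
set m := lbl i; set n := lbl j; rewrite oppr_eq0 normrN.
have conjV (x : R[i]) : conjc (x / (Num.sqrt 2)%:C) = conjc x / (Num.sqrt 2)%:C.
  by rewrite rmorphM fmorphV; congr (_ * _^-1); exact: conjc_real.
have conjS (b : bool) : conjc ((-1) ^+ b) = (-1) ^+ b :> R[i].
  by rewrite rmorphXn rmorphN1.
have conj_i : conjc 'i%C = - 'i%C :> R[i].
  by apply/eqP; rewrite eq_complex /= oppr0 !eqxx.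
case: ifPn => [/andP[_ /eqP->]|mn0]; first by rewrite rmorph1 mulr1.
case: ifPn => [_|]; first by rewrite rmorph0 mulr0.
rewrite negbK => /eqP absE.
have on : odd `|n| = odd `|m| by lia.
rewrite on.
have ss : (-1) ^+ odd `|m| * (-1) ^+ odd `|m| = 1 :> R[i].
  by rewrite -signr_addb addbb.
case: ifPn => m_gt0; case: (eqVneq n m) => nm.
- rewrite (_ : (- n == m) = false); last by lia.
  by rewrite conjV conjS mulrA mulr1.
- rewrite (_ : (- n == m) = true); last by lia.
  by rewrite conjV rmorph1 mulrA ss.
- rewrite (_ : (- n == m) = false); last by lia.
  rewrite conjV conj_i; transitivity ((-1) ^+ odd `|m| * (-1) ^+ odd `|m| * (- 'i%C / (Num.sqrt 2)%:C) : R[i]); first by rewrite ss mul1r.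
  by rewrite -!mulrA; congr (_ * _); rewrite mulrCA.
- rewrite (_ : (- n == m) = true); last by lia.
  rewrite conjV (_ : conjc _ = (-1) ^+ odd `|m| * 'i%C) ?mulrA//.
  rewrite [LHS]rmorphM [RHS]mulrC; congr (_ * _); last exact: conjS.
  by apply/eqP; rewrite eq_complex /= oppr0 opprK !eqxx.
Qed.

Let conj_expi t : conjc (expi t) = expi (- t).
Proof. by rewrite /expi /= cosN sinN. Qed.

Let conj_wigner l Q (i j : 'I_(l.*2.+1)) :
  conjc (wigner_D l Q i j) = sg i * sg j * wigner_D l Q (rev_ord i) (rev_ord j).
Proof.
have conjM (x y : R[i]) : conjc (x * y) = conjc x * conjc y by exact: rmorphM.
rewrite mxE [in RHS]mxE !lbl_rev !conjM !conj_expi conjc_real.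
rewrite (signsym_mexp (@signsym_gen l _)) sg_mul.
have realM (x y : R) : (x * y)%:C = x%:C * y%:C :> R[i] by rewrite rmorphM.
have realX k : ((-1) ^+ k)%:C = (-1) ^+ k :> R[i] by rewrite rmorphXn rmorphN1.
rewrite realM realX !mulrNz !mulNr !opprK.
have s2 : (-1) ^+ (i + j) * (-1) ^+ (i + j) = 1 :> R[i].
  by rewrite -exprD addnn -signr_odd odd_double.
by rewrite !mulrA [_ * expi _ * _]mulrAC s2 mul1r.
Qed.

Lemma cplx_harmonic_real l Q i j : complex.Im (cplx_harmonic l Q i j) = 0.
Proof.
have conjM (x y : R[i]) : conjc (x * y) = conjc x * conjc y by exact: rmorphM.
suff: conjc (cplx_harmonic l Q i j) = cplx_harmonic l Q i j.
  by case: (cplx_harmonic l Q i j) => a b /= [bb]; lra.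
rewrite !mxE rmorph_sum [RHS](reindex_inj rev_ord_inj); apply: eq_bigr => q _.
rewrite [LHS]conjM; set z := _^T q j; set z' := _^T _ j.
have -> : conjc z = sg q * z' by rewrite /z /z' ![_^T _ _]mxE conj_basis.
rewrite !mxE rmorph_sum [X in _ = X * _](reindex_inj rev_ord_inj) !mulr_suml.
apply: eq_bigr => p _; rewrite [X in X * _ = _]conjM conj_wigner.
rewrite ![map_mx _ _ _ _]mxE conjcK conj_basis rev_ordK.
have -> : sg (rev_ord p) = sg p by rewrite /sg lbl_rev abszN.
rewrite -[RHS]mul1r -(sg_sqr q); ring.
Qed.


End Defs.

(* Main.v *)
Require Import Defs.
From mathcomp Require Import all_boot all_order all_algebra.
From mathcomp Require Import all_classical all_reals all_analysis.
From mathcomp Require Import zify ring lra.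

(** At a grid point, [f] is a finite combination of harmonics of degree less than
    [B]. Its coefficients can be read off as soon as these harmonics are orthogonal
    for the weighted sum over the grid, with squared norm [1 / (2 l + 1)], as they
    are for the Haar measure; this is [harmonic_grid_orthogonal]. The change of
    basis to real harmonics is unitary ([real_basis_unitary]), so it suffices to
    treat the entries [expi (- m a) * d^l_(m,n) b * expi (- n g)] of the Wigner
    matrices. The sums over [a] and [g] are sums of powers of roots of unity of
    order dividing [2 B], and leave only equal labels, since two labels of degree
    less than [B] differ by less than [2 B]. What remains is the orthogonality of
    [d^l_(m,n)] and [d^l'_(m,n)] at the polar nodes
    ([wigner_d_grid_orthogonal]).

    The weights are made so that summing [w_k * G' (beta_k) / sin beta_k] gives
    [(G pi - G 0) / (8 B^2)] for all even trigonometric polynomials [G] of degree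
    at most [2 B] ([grid_quadrature_derive]). This exactness replaces the integral
    over the polar angle: it permits integration by parts directly on the grid.

    Integration by parts is applied to the two first-order relations between
    neighbouring columns [n] and [n + 1] of the d-matrix, which are adjoint to each
    other up to sign ([polar_sum_ladder]). They give a recursion in [n] for the
    product of [d^l_(m,n)] and [d^l'_(m,n)]. For [l' < l] the recursion starts at
    zero, because [d^l'] has no column [- l' - 1]; hence the product vanishes. For
    [l = l'] it shows that the norm does not depend on [n], and since the matrix is
    orthogonal the [2 l + 1] norms add up to the total weight.

    The relations themselves are read on a closed form: up to normalization,
    [d^l_(m,n)] is the coefficient of degree [l + m] in
    [(c X + s)^(l + n) * (- s X + c)^(l - n)], where [c] and [s] are the cosine and
    sine of the half-angle ([wigner_dE]). This form also bounds the trigonometric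
    degree of the products. It is identified with the matrix exponential by its
    linear differential equation ([mexp_ode]); the same lemma computes the rotation
    matrices, from which the Euler angles of the grid points are recovered
    ([euler_anglesK]). *)

Local Open Scope ring_scope.
Set Implicit Arguments.
Unset Strict Implicit.
Unset Printing Implicit Defensive.
Import Order.TTheory GRing.Theory Num.Theory.
Import numFieldNormedType.Exports.

(** * Derivatives of matrix exponentials *)

Section MatrixExponential.
Variable R : realType.

Lemma is_derive_ext (f g : R -> R) (x df : R) : f =1 g -> is_derive x 1 f df ->
  is_derive x 1 g df.
Proof. by move=> /funext ->. Qed.

Lemma is_derive_big (I : finType) (h : I -> R -> R) (dh : I -> R) (x : R) :
  (forall i, is_derive x 1 (h i) (dh i)) ->
  is_derive x 1 (fun y => \sum_i h i y) (\sum_i dh i).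
Proof.
move=> hd; pose P (g : R -> R) (d : R) := is_derive x 1 g d.
rewrite (_ : (fun y => \sum_i h i y) = \sum_i h i); last first.
  by apply/funext => y; rewrite fct_sumE.
apply: (@big_ind2 _ _ P) => [|? ? ? ? ? ?|i _]; last exact: hd.
- exact: is_derive_cst.
- exact: is_deriveD.
Qed.

Lemma is_derive_prod (f g : R -> R) (x df dg : R) :
  is_derive x 1 f df -> is_derive x 1 g dg ->
  is_derive x 1 (fun y => f y * g y) (df * g x + f x * dg).
Proof.
move=> dfx dgx; have dfg := is_deriveM dfx dgx.
have -> : df * g x + f x * dg = f x *: dg + g x *: df.
  by rewrite /GRing.scale /=; ring.
exact: dfg.
Qed.

(** The derivative is taken entry by entry: every fact used below is about real
    functions, and no norm on matrices has to be differentiated. *)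
Definition mx_derive n (M : R -> 'M[R]_n) (dM : 'M[R]_n) (x : R) :=
  forall i j, is_derive x 1 (fun y => M y i j) (dM i j).

Lemma mx_deriveM n (M N : R -> 'M[R]_n) dM dN x :
  mx_derive M dM x -> mx_derive N dN x ->
  mx_derive (fun y => M y *m N y) (dM *m N x + M x *m dN) x.
Proof.
move=> dMx dNx i j; rewrite !mxE -big_split /=.
apply: is_derive_ext (fun y => esym (mxE _ _ _ _)) _.
apply: is_derive_big => k.
exact: is_derive_prod.
Qed.

Lemma mx_derive_tr n (M : R -> 'M[R]_n) dM x :
  mx_derive M dM x -> mx_derive (fun y => (M y)^T) dM^T x.
Proof.
move=> dMx i j; rewrite mxE; apply: is_derive_ext (dMx j i) => y.
by rewrite mxE.
Qed.

Lemma mx_derive0_cst n (M : R -> 'M[R]_n) :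
  (forall x, mx_derive M 0 x) -> forall x, M x = M 0.
Proof.
move=> dM x; apply/matrixP => i j.
apply: (@is_derive_0_is_cst _ (fun y => M y i j)) => y.
by have := dM y i j; rewrite mxE.
Qed.

Let coef n (A : 'M[R]_n.+1) i j (k : nat) : R := (k`!%:R)^-1 * (A ^+ k) i j.

Let coef_series n (A : 'M[R]_n.+1) i j x :
  (fun k => series (fun k => (k`!%:R)^-1 *: (x *: A) ^+ k) k i j)
  = pseries (coef A i j) x.
Proof.
apply/funext => k; rewrite /series /pseries /= summxE; apply: eq_bigr => p _.
by rewrite exprZn !mxE /coef; ring.
Qed.

Let cvg_coef n (A : 'M[R]_n.+1) i j x :
  (pseries (coef A i j) x @ \oo --> mexp (x *: A) i j)%classic.
Proof.
rewrite -coef_series.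
apply: (cvg_comp (series (fun k => (k`!%:R)^-1 *: (x *: A) ^+ k))
  (fun M : 'M[R]_n.+1 => M i j)); first exact: is_cvg_mexp.
exact: coord_continuous.
Qed.

Let mexp_coef n (A : 'M[R]_n.+1) i j x :
  mexp (x *: A) i j = limn (pseries (coef A i j) x).
Proof. by apply/esym/cvg_lim => //; apply: cvg_coef. Qed.

Let fact_ratio k : k.+1%:R * (k.+1`!%:R)^-1 = (k`!%:R)^-1 :> R.
Proof. by rewrite factS natrM invfM mulrA divff ?mul1r// pnatr_eq0. Qed.

Let diffs_coef n (A : 'M[R]_n.+1) i j :
  pseries_diffs (coef A i j) = fun k => (k`!%:R)^-1 * (A ^+ k.+1) i j.
Proof.
by apply/funext => k; rewrite /pseries_diffs /coef mulrA fact_ratio.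
Qed.

Let cvg_diffs n (A B : 'M[R]_n.+1) i j x :
  (pseries (fun k => (k`!%:R)^-1 * (A ^+ k * B) i j) x @ \oo -->
     (mexp (x *: A) *m B) i j)%classic.
Proof.
rewrite mxE (_ : pseries _ _ =
  fun k => \sum_p pseries (coef A i p) x k * B p j); last first.
  apply/funext => k; rewrite /pseries /series /= [LHS](eq_bigr (fun q =>
    \sum_p coef A i p q * x ^+ q * B p j)) => [|q _].
    by rewrite exchange_big /=; apply: eq_bigr => p _; rewrite mulr_suml.
  rewrite mxE !mulr_sumr mulr_suml; apply: eq_bigr => p _; rewrite /coef; ring.
apply: cvg_big => [|p _]; [exact: add_continuous | apply: cvgM; [exact: cvg_coef | exact: cvg_cst]].
Qed.

(** Each entry of [mexp (y *: A)] is a power series in [y], with coefficients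
    [(A ^+ k) i j / k`!]; shifting the coefficients by one multiplies the matrix
    by [A], so term-by-term differentiation gives the claim. *)
Lemma mexp_derive n (A : 'M[R]_n.+1) x :
  mx_derive (fun y => mexp (y *: A)) (mexp (x *: A) *m A) x.
Proof.
move=> i j; apply: is_derive_ext (fun y => esym (mexp_coef A i j y)) _.
(* Any point of modulus larger than that of [x] would do instead of [`|x| + 1]: the
   series and its first two term-by-term derivatives converge everywhere. *)
have := @pseries_snd_diffs _ (coef A i j) (`|x| + 1) x.
have diffs2 : pseries_diffs (pseries_diffs (coef A i j))
    = fun k => (k`!%:R)^-1 * (A ^+ k * (A * A)) i j.
  rewrite diffs_coef; apply/funext => k.
  by rewrite /pseries_diffs [LHS]mulrA fact_ratio !exprSr mulrA.
have diffs1 : pseries_diffs (coef A i j) = fun k => (k`!%:R)^-1 * (A ^+ k * A) i j.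
  by rewrite diffs_coef; apply/funext => k; rewrite exprSr.
have -> : limn (pseries (pseries_diffs (coef A i j)) x) = (mexp (x *: A) *m A) i j.
  by apply/cvg_lim => //; rewrite diffs1; apply: cvg_diffs.
apply.
- by apply: cvgP; exact: cvg_coef.
- by rewrite diffs1; apply: cvgP; exact: cvg_diffs.
- by rewrite diffs2; apply: cvgP; exact: cvg_diffs.
- by rewrite [ltRHS]ger0_norm ?addr_ge0// ltrDl.
Qed.

Lemma mexp0 n : mexp (0 : 'M[R]_n.+1) = 1%:M.
Proof.
apply/cvg_lim => //; apply: cvg_near_cst; exists 1%N => // k /= k_gt0.
rewrite /series /= big_ltn // expr0 invr1 scale1r big_nat_cond big1 ?addr0//.
by move=> p /andP[/andP[p0 _] _]; rewrite expr0n eqn0Ngt p0 scaler0.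
Qed.

Lemma mexp_commute n (A : 'M[R]_n.+1) x :
  mexp (x *: A) *m A = A *m mexp (x *: A).
Proof.
apply/matrixP => i j.
have lim : (pseries (fun k => (k`!%:R)^-1 * (A ^+ k * A) i j) x @ \oo -->
     (A *m mexp (x *: A)) i j)%classic.
  rewrite mxE (_ : pseries _ _ =
    fun k => \sum_p A i p * pseries (coef A p j) x k); last first.
    apply/funext => k; rewrite /pseries /series /= [LHS](eq_bigr (fun q =>
      \sum_p A i p * (coef A p j q * x ^+ q))) => [|q _].
      by rewrite exchange_big /=; apply: eq_bigr => p _; rewrite mulr_sumr.
    rewrite -exprSr exprS mxE !mulr_sumr mulr_suml.
    by apply: eq_bigr => p _; rewrite /coef; ring.
  apply: cvg_big => [|p _]; first exact: add_continuous.
  by apply: cvgM; [exact: cvg_cst | exact: cvg_coef].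
exact: (cvg_unique (@norm_hausdorff _ _) (@cvg_diffs n A A i j x) lim).
Qed.

(** If [M' = M A] then [M y *m mexp (y *: - A)] has derivative zero, hence equals
    its value 1 at 0. The same holds for [mexp (y *: A)] in place of [M], so both
    are the inverse of [mexp (y *: - A)]. This is how every exponential below is
    computed: the candidate is only differentiated, no power of [A] is expanded. *)
Lemma mexp_ode n (A : 'M[R]_n.+1) (M : R -> 'M[R]_n.+1) :
  M 0 = 1%:M -> (forall x, mx_derive M (M x *m A) x) ->
  forall x, M x = mexp (x *: A).
Proof.
pose E x := mexp (x *: - A).
have inv (N : R -> 'M[R]_n.+1) : N 0 = 1%:M ->
    (forall x, mx_derive N (N x *m A) x) -> forall x, N x *m E x = 1%:M.
  move=> N0 dN x; rewrite (@mx_derive0_cst _ (fun y => N y *m E y)).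
    by rewrite N0 /E scale0r mexp0 mulmx1.
  move=> y; have := mx_deriveM (dN y) (@mexp_derive _ (- A) y).
  by rewrite mexp_commute -[N y *m A *m _]mulmxA mulNmx mulmxN addrN.
move=> M0 dM x.
have Einv : mexp (x *: A) *m E x = 1%:M.
  apply: (inv (fun y => mexp (y *: A))) => [|y]; last exact: mexp_derive.
  by rewrite scale0r mexp0.
by rewrite -[LHS]mulmx1 -(mulmx1C Einv) mulmxA inv // mul1mx.
Qed.

(** With [E] the exponential, the derivative of [E *m E^T] is
    [E A E^T + E A^T E^T = 0]. *)
Lemma mexp_orthogonal n (A : 'M[R]_n.+1) x : A^T = - A ->
  mexp (x *: A) *m (mexp (x *: A))^T = 1%:M.
Proof.
move=> AT; rewrite (@mx_derive0_cst _ (fun y => mexp (y *: A) *m (mexp (y *: A))^T)).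
  by rewrite scale0r mexp0 trmx1 mulmx1.
move=> y; have := mx_deriveM (@mexp_derive _ A y) (mx_derive_tr (@mexp_derive _ A y)).
by rewrite trmx_mul AT mulNmx mulmxN mulmxA addrN.
Qed.

End MatrixExponential.

(** * Rotations and recovery of the Euler angles *)

Section EulerAngles.
Variable R : realType.
Implicit Types a b g : R.

Definition mx33 (rows : seq (seq R)) : 'M[R]_3 :=
  \matrix_(i, j) (nth [::] rows i)`_j.

Definition rotz a : 'M[R]_3 :=
  mx33 [:: [:: cos a; - sin a; 0]; [:: sin a; cos a; 0]; [:: 0; 0; 1]].

Definition roty b : 'M[R]_3 :=
  mx33 [:: [:: cos b; 0; sin b]; [:: 0; 1; 0]; [:: - sin b; 0; cos b]].

Lemma hat_e3 : hat (e3 R) = mx33 [:: [:: 0; -1; 0]; [:: 1; 0; 0]; [:: 0; 0; 0]].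
Proof.
apply/matrixP => -[[|[|[|//]]] i3] [[|[|[|//]]] j3]; rewrite !mxE /=; lra.
Qed.

Lemma hat_e2 : hat (e2 R) = mx33 [:: [:: 0; 0; 1]; [:: 0; 0; 0]; [:: -1; 0; 0]].
Proof.
apply/matrixP => -[[|[|[|//]]] i3] [[|[|[|//]]] j3]; rewrite !mxE /=; lra.
Qed.

Let d_cst (c x e : R) : e = 0 -> is_derive x 1 (fun=> c) e.
Proof. by move=> ->; exact: is_derive_cst. Qed.

Let d_cos (x e : R) : e = - sin x -> is_derive x 1 (fun y => cos y) e.
Proof. by move=> ->; exact: is_derive_cos. Qed.

Let d_sin (x e : R) : e = cos x -> is_derive x 1 (fun y => sin y) e.
Proof. by move=> ->; exact: is_derive_sin. Qed.

Let d_Nsin (x e : R) : e = - cos x -> is_derive x 1 (fun y => - sin y) e.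
Proof. by move=> ->; exact: is_deriveN. Qed.

Lemma mexp_hat_e3 a : mexp (a *: hat (e3 R)) = rotz a.
Proof.
apply/esym/mexp_ode => [|x i j].
  by apply/matrixP => -[[|[|[|//]]] i3] [[|[|[|//]]] j3];
    rewrite !mxE /= ?cos0 ?sin0 ?oppr0.
rewrite hat_e3 !mxE !big_ord_recl big_ord0 /=.
apply: is_derive_ext (fun y => esym (mxE _ _ _ _)) _.
move: i j => [[|[|[|//]]] i3] [[|[|[|//]]] j3]; rewrite !mxE /=.
all: by (apply: d_cst + apply: d_cos + apply: d_sin + apply: d_Nsin); ring.
Qed.

Lemma mexp_hat_e2 b : mexp (b *: hat (e2 R)) = roty b.
Proof.
apply/esym/mexp_ode => [|x i j].
  by apply/matrixP => -[[|[|[|//]]] i3] [[|[|[|//]]] j3];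
    rewrite !mxE /= ?cos0 ?sin0 ?oppr0.
rewrite hat_e2 !mxE !big_ord_recl big_ord0 /=.
apply: is_derive_ext (fun y => esym (mxE _ _ _ _)) _.
move: i j => [[|[|[|//]]] i3] [[|[|[|//]]] j3]; rewrite !mxE /=.
all: by (apply: d_cst + apply: d_cos + apply: d_sin + apply: d_Nsin); ring.
Qed.

Lemma eulerE a b g : euler a b g = rotz a *m roty b *m rotz g.
Proof. by rewrite /euler !mexp_hat_e3 mexp_hat_e2. Qed.

Lemma det3 (M : 'M[R]_3) : \det M =
  M 0 0 * (M 1 1 * M 2 2 - M 1 2 * M 2 1)
  - M 0 1 * (M 1 0 * M 2 2 - M 1 2 * M 2 0)
  + M 0 2 * (M 1 0 * M 2 1 - M 1 1 * M 2 0).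
Proof.
have det2 (N : 'M[R]_2) : \det N = N 0 0 * N 1 1 - N 0 1 * N 1 0.
  rewrite (expand_det_row _ 0) !big_ord_recl big_ord0 /cofactor !det_mx11 !mxE /=.
  rewrite (_ : lift _ _ = 1 :> 'I_2); last exact: val_inj.
  rewrite (_ : lift _ _ = 0 :> 'I_2); last exact: val_inj.
  by rewrite expr0 expr1; ring.
rewrite (expand_det_row _ 0) !big_ord_recl big_ord0 /cofactor !det2 !mxE /=.
have l00 : lift (0 : 'I_3) (0 : 'I_2) = 1 by exact: val_inj.
have l01 : lift (0 : 'I_3) (1 : 'I_2) = 2 by exact: val_inj.
have l10 : lift (1 : 'I_3) (0 : 'I_2) = 0 by exact: val_inj.
have l11 : lift (1 : 'I_3) (1 : 'I_2) = 2 by exact: val_inj.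
have l20 : lift (2 : 'I_3) (0 : 'I_2) = 0 by exact: val_inj.
have l21 : lift (2 : 'I_3) (1 : 'I_2) = 1 by exact: val_inj.
have o0 : ord0 = 0 :> 'I_2 by exact: val_inj.
have o1 : lift ord0 ord0 = 1 :> 'I_2 by exact: val_inj.
rewrite ?o0 ?o1 ?l00 ?l01 ?l10 ?l11 ?l20 ?l21 /bump /=.
rewrite expr0 expr1 expr2; ring.
Qed.

Lemma rotz_SO3 a : rotz a \in @SO3 R.
Proof.
apply/andP; split; apply/eqP.
  apply/matrixP => -[[|[|[|//]]] i3] [[|[|[|//]]] j3];
  rewrite !mxE !big_ord_recl big_ord0 !mxE /=; have := cos2Dsin2 a; lra.
by rewrite det3 !mxE /=; have := cos2Dsin2 a; lra.
Qed.

Lemma roty_SO3 b : roty b \in @SO3 R.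
Proof.
apply/andP; split; apply/eqP.
  apply/matrixP => -[[|[|[|//]]] i3] [[|[|[|//]]] j3];
  rewrite !mxE !big_ord_recl big_ord0 !mxE /=; have := cos2Dsin2 b; lra.
by rewrite det3 !mxE /=; have := cos2Dsin2 b; lra.
Qed.

Lemma mul_SO3 (P Q : 'M[R]_3) : P \in @SO3 R -> Q \in @SO3 R -> P *m Q \in @SO3 R.
Proof.
move=> /andP[/eqP PP /eqP dP] /andP[/eqP QQ /eqP dQ].
apply/andP; split; apply/eqP; last by rewrite det_mulmx dP dQ mulr1.
by rewrite trmx_mul mulmxA -(mulmxA Q^T) PP mulmx1.
Qed.

Lemma euler_SO3 a b g : euler a b g \in @SO3 R.
Proof. by rewrite eulerE !mul_SO3 ?rotz_SO3 ?roty_SO3. Qed.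

Lemma euler_entries a b g :
  [/\ euler a b g 2 2 = cos b,
      euler a b g 0 2 = cos a * sin b, euler a b g 1 2 = sin a * sin b,
      euler a b g 2 0 = - (sin b * cos g) & euler a b g 2 1 = sin b * sin g].
Proof.
rewrite eulerE; split; rewrite !mxE !big_ord_recl big_ord0 !mxE
  !big_ord_recl !big_ord0 !mxE /=; ring.
Qed.

(** The hypotheses say that [cos (s - t) = 1]; since
    [cos (s - t) = 1 - 2 sin ((s - t) / 2) ^+ 2] and the half-difference lies in
    [0, pi[, it vanishes. *)
Lemma angle_inj (s t : R) : 0 <= s < 2 * pi -> 0 <= t < 2 * pi ->
  cos s = cos t -> sin s = sin t -> s = t.
Proof.
wlog le_ts : s t / t <= s => [hw|] s2 t2 cst sst.
  by case/orP: (le_total t s) => ?; [|apply/esym]; apply: hw.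
have c1 : cos (s - t) = 1 by rewrite cosB cst sst; have := cos2Dsin2 t; lra.
have s0 : sin ((s - t) / 2) = 0.
  have := cos_mulr2n ((s - t) / 2).
  have -> : (s - t) / 2 *+ 2 = s - t by rewrite mulr2n; lra.
  rewrite c1 cos2sin2 => h; apply/eqP; rewrite -sqrf_eq0; apply/eqP; lra.
apply: contra_eq s0 => st; rewrite gt_eqF// sin_gt0_pi//.
have : t < s by rewrite lt_neqAle eq_sym st.
by move: s2 t2 => /andP[? ?] /andP[? ?] ?; apply/andP; split; lra.
Qed.

(** Away from the poles the angles are determined by the rotation, so the value
    picked by [euler_angles] is the triple itself: the (2,2) entry gives [b], and
    dividing the other entries of the last column and row by [sin b != 0] gives the
    cosines and sines of [a] and [g]. *)
Lemma euler_anglesK a b g :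
  0 <= a < 2 * pi -> 0 < b < pi -> 0 <= g < 2 * pi ->
  euler_angles (euler a b g) = (a, b, g).
Proof.
move=> ha hb hg; rewrite /euler_angles.
set S := (X in xget _ X).
have : S (xget (0, 0, 0) S).
  apply: xgetPex; exists (a, b, g); split=> //=.
  by case/andP: hb => ? ?; rewrite !ltW.
case: (xget _ S) => -[a' b'] g' [/= ha' hb' hg' E].
have [e22 e02 e12 e20 e21] := euler_entries a b g.
have [] := euler_entries a' b' g'; rewrite E e22 e02 e12 e20 e21 => c22 c02 c12 c20 c21.
have bb : b = b'.
  apply: cos_inj c22; rewrite in_itv /=; last exact: hb'.
  by case/andP: hb => ? ?; rewrite !ltW.
subst b'; have sb : sin b != 0 by rewrite gt_eqF // sin_gt0_pi.
have <- : a = a'.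
  by apply: angle_inj => //; apply: (mulIf sb).
have <- : g = g' => //.
apply: angle_inj => //; apply: (mulfI sb) => //.
by apply: oppr_inj.
Qed.

Lemma wigner_D_euler l a b g :
  0 <= a < 2 * pi -> 0 < b < pi -> 0 <= g < 2 * pi ->
  wigner_D l (euler a b g) = wigner_euler l a b g.
Proof. by move=> ha hb hg; rewrite /wigner_D euler_anglesK. Qed.

End EulerAngles.

(** * Wigner functions as polynomial coefficients *)

Section WignerPolynomials.
Variable R : realType.
Implicit Types (a b k : nat) (x : R).

(** The rotation by [x / 2] of the plane acts on binary forms; [rotU] and [rotV] are
    the images of the two variables, dehomogenized by setting the second one to 1. *)
Definition rotU x : {poly R} := (cos (x / 2))%:P * 'X + (sin (x / 2))%:P.
Definition rotV x : {poly R} := - (sin (x / 2))%:P * 'X + (cos (x / 2))%:P.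

Definition wpoly a b x : {poly R} := rotU x ^+ a * rotV x ^+ b.

(** The forms of degree [2 l = a + b] carry the representation of dimension
    [2 l + 1], and [wcoef a b k] is its matrix entry at row [k = l + m] and column
    [a = l + n] in the basis of monomials. *)
Definition wcoef a b k x : R := (wpoly a b x)`_k.

Lemma cos_half x : cos x = cos (x / 2) ^+ 2 - sin (x / 2) ^+ 2.
Proof. by rewrite [in LHS](_ : x = x / 2 + x / 2) ?cosD -?expr2//; lra. Qed.

Lemma sin_half x : sin x = 2 * (cos (x / 2) * sin (x / 2)).
Proof. by rewrite [in LHS](_ : x = x / 2 + x / 2) ?sinD; [ring | lra]. Qed.

Definition poly_derive (f : R -> {poly R}) (df : {poly R}) x :=
  forall k, is_derive x 1 (fun y => (f y)`_k) df`_k.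

Lemma poly_deriveM (f g : R -> {poly R}) df dg x :
  poly_derive f df x -> poly_derive g dg x ->
  poly_derive (fun y => f y * g y) (df * g x + f x * dg) x.
Proof.
move=> dfx dgx k; rewrite coefD !coefM -big_split /=.
apply: is_derive_ext (fun y => esym (coefM _ _ _)) _.
by apply: is_derive_big => i; apply: is_derive_prod.
Qed.

Lemma poly_deriveX (f : R -> {poly R}) df x n :
  poly_derive f df x ->
  poly_derive (fun y => f y ^+ n) (n%:R * (f x ^+ n.-1 * df)) x.
Proof.
move=> dfx; elim: n => [|n IHn] k.
  rewrite mul0r coef0; exact: (is_derive_cst (1 : {poly R})`_k).
apply: is_derive_ext (fun y => congr1 (fun p : {poly R} => p`_k) (esym (exprS _ _))) _.
have := poly_deriveM dfx IHn k.
suff -> : df * f x ^+ n + f x * (n%:R * (f x ^+ n.-1 * df))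
  = n.+1%:R * (f x ^+ n * df) by [].
by case: n {IHn} => [|n] /=; rewrite ?expr0 ?exprS -?natr1; ring.
Qed.

Let half_derive (x : R) : is_derive x 1 (fun y => y / 2) 2^-1.
Proof.
have := is_derive_prod (is_derive_id x 1) (is_derive_cst (2^-1 : R) x 1).
by rewrite mulr0 addr0 mul1r.
Qed.

Let cos_half_derive x : is_derive x 1 (fun y => cos (y / 2)) (- (2^-1 * sin (x / 2))).
Proof.
have := @is_derive1_comp R cos (fun y => y / 2) x _ _ (is_derive_cos (x / 2)) (half_derive x).
by rewrite mulrC mulrN.
Qed.

Let sin_half_derive x : is_derive x 1 (fun y => sin (y / 2)) (2^-1 * cos (x / 2)).
Proof.
have := @is_derive1_comp R sin (fun y => y / 2) x _ _ (is_derive_sin (x / 2)) (half_derive x).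
by rewrite mulrC.
Qed.

Let lin_coef (p q : R) k :
  (p%:P * 'X + q%:P)`_k = if k is k'.+1 then (if k' is 0 then p else 0) else q.
Proof.
by rewrite coefD coefMX coefC coefC; case: k => [|[|k]] /=; rewrite ?addr0 ?add0r.
Qed.

Lemma rotU_derive x : poly_derive rotU (2^-1%:P * rotV x) x.
Proof.
move=> k; rewrite /rotV mulrDr mulrA -polyCN -!polyCM lin_coef.
apply: is_derive_ext (fun y => esym (lin_coef _ _ _)) _.
case: k => [|[|k]]; [exact: sin_half_derive | | exact: is_derive_cst].
by rewrite mulrN; exact: cos_half_derive.
Qed.

Lemma rotV_derive x : poly_derive rotV (- (2^-1%:P * rotU x)) x.
Proof.
move=> k; rewrite /rotU mulrDr mulrA opprD -mulNr -!polyCM -!polyCN lin_coef.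
rewrite /rotV; apply: is_derive_ext (fun y => _) _.
  by move=> y; rewrite -polyCN lin_coef.
case: k => [|[|k]]; [exact: cos_half_derive | | exact: is_derive_cst].
by have := is_deriveN (sin_half_derive x).
Qed.

(** Comes from [rotU' = rotV / 2] and [rotV' = - rotU / 2]. *)
Lemma wcoef_derive a b k x : is_derive x 1 (wcoef a b k)
  (2^-1 * (a%:R * wcoef a.-1 b.+1 k x - b%:R * wcoef a.+1 b.-1 k x)).
Proof.
have := poly_deriveM (poly_deriveX a (rotU_derive x)) (poly_deriveX b (rotV_derive x)) k.
rewrite [X in is_derive _ _ _ X](_ : _ =
  2^-1 * (a%:R * wcoef a.-1 b.+1 k x - b%:R * wcoef a.+1 b.-1 k x)) //.
rewrite /wcoef -!coefZ -coefB -coefZ.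
apply: (congr1 (fun p : {poly R} => p`_k)); rewrite /wpoly -!mul_polyC !polyC_natr.
by case: a b => [|a] [|b] /=; rewrite ?exprS ?expr0; ring.
Qed.

(** Compares two computations of a coefficient of [X p'] for [p = wpoly a b x]: it
    multiplies the k-th coefficient by [k], and it can be written with [rotU] and
    [rotV] because ['X = cos (x / 2) rotU - sin (x / 2) rotV]. With the labels
    [m = k - l] and [n = a - l], where [2 l = a + b], the factor on the left is
    [m - n cos x]. Adding or subtracting the derivative formula isolates one of
    the two neighbouring columns. *)
Lemma wcoef_degree_relation a b k x :
  (k%:R - (a + b)%:R / 2 - (a%:R - b%:R) / 2 * cos x) * wcoef a b k x =
  - (sin x / 2) * (a%:R * wcoef a.-1 b.+1 k x + b%:R * wcoef a.+1 b.-1 k x).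
Proof.
set c := cos (x / 2); set s := sin (x / 2).
have c2s2 : c%:P ^+ 2 + s%:P ^+ 2 = 1 :> {poly R}.
  by rewrite -!polyC_exp -polyCD cos2Dsin2.
have XE : 'X = c%:P * rotU x - s%:P * rotV x :> {poly R}.
  by rewrite -[LHS]mul1r -c2s2 /rotU /rotV -/c -/s; ring.
have euler_op : 'X * (wpoly a b x)^`() =
    (a%:R * c%:P ^+ 2 + b%:R * s%:P ^+ 2) * wpoly a b x
    - c%:P * s%:P * (a%:R * wpoly a.-1 b.+1 x + b%:R * wpoly a.+1 b.-1 x).
  have dU : (rotU x)^`() = c%:P.
    by rewrite derivD derivM !derivC derivX mul0r add0r mulr1 addr0.
  have dV : (rotV x)^`() = - s%:P.
    by rewrite derivD derivM -polyCN !derivC derivX mul0r add0r mulr1 addr0.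
  rewrite XE /wpoly derivM !deriv_exp dU dV.
  by case: a b => [|a] [|b] /=; rewrite ?exprS ?expr0; ring.
have coefXd (p : {poly R}) : ('X * p^`())`_k = k%:R * p`_k.
  by rewrite mulr_natl coefXM; case: k => [|k] //=; rewrite coef_deriv.
have := congr1 (fun p : {poly R} => p`_k) euler_op.
rewrite coefXd -!polyC_natr -!polyC_exp -!polyCM -polyCD coefB !coefCM coefD !coefCM.
rewrite -/(wcoef _ _ _ _) -/(wcoef a.-1 b.+1 k x) -/(wcoef a.+1 b.-1 k x).
rewrite sin_half (cos_half x) -/c -/s natrD mulrBl mulrBl => ->.
have : c ^+ 2 + s ^+ 2 = 1 by exact: cos2Dsin2.
move: (wcoef a b k x) (wcoef a.-1 _ _ _) (wcoef a.+1 _ _ _) => p q r cs1.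
have -> : c ^+ 2 = 1 - s ^+ 2 by rewrite -cs1; ring.
by field.
Qed.

End WignerPolynomials.

(** * Closed form of the Wigner d-matrix *)

Section WignerD.
Variable R : realType.
Variable l : nat.
Implicit Types (i j k : nat) (x : R).

(** Norm of the monomial of degree [j], up to a common factor, for the inner
    product on binary forms that rotations preserve. *)
Definition wnorm j : R := Num.sqrt (j`! * (l.*2 - j)`!)%:R.

Lemma wnorm_gt0 j : 0 < wnorm j.
Proof. by rewrite sqrtr_gt0 ltr0n muln_gt0 !fact_gt0. Qed.

Let wnormS j : (j < l.*2)%N ->
  wnorm j.+1 * Num.sqrt (l.*2 - j)%:R = wnorm j * Num.sqrt j.+1%:R.
Proof.
move=> jl; rewrite /wnorm -!sqrtrM ?ler0n// -!natrM; congr (Num.sqrt _%:R).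
have -> : (l.*2 - j = (l.*2 - j.+1).+1)%N by lia.
by rewrite !factS; ring.
Qed.

(** In terms of positions [k = l + m] the square roots have natural arguments. *)
Lemma wigner_genE (k j : 'I_(l.*2.+1)) : wigner_gen R l k j =
  - 2^-1 * (Num.sqrt k%:R * Num.sqrt (l.*2 - k).+1%:R) * (k == j.+1 :> nat)%:R
  + 2^-1 * (Num.sqrt (l.*2 - k)%:R * Num.sqrt k.+1%:R) * (k.+1 == j :> nat)%:R.
Proof.
have kl := ltn_ord k; have jl := ltn_ord j.
rewrite mxE /= -!sqrtrM ?ler0n// -!natrM /lbl.
congr (_ * Num.sqrt _ * _%:R + _ * Num.sqrt _ * _%:R).
- by rewrite [RHS]pmulrn; congr (_%:~R); rewrite PoszM; congr (_ * _); lia.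
- by lia.
- by rewrite [RHS]pmulrn; congr (_%:~R); rewrite PoszM; congr (_ * _); lia.
- by lia.
Qed.

Lemma wigner_gen_skew : (wigner_gen R l)^T = - wigner_gen R l.
Proof.
apply/matrixP => i j; rewrite [LHS]mxE [RHS]mxE !wigner_genE opprD -!mulNr opprK addrC.
have il := ltn_ord i; have jl := ltn_ord j.
congr (_ + _); case: eqVneq => [ij|_]; rewrite ?mulr0//.
  by rewrite -ij (_ : l.*2 - j = (l.*2 - j.+1).+1)%N; [ring | lia].
by rewrite ij (_ : l.*2 - i = (l.*2 - i.+1).+1)%N; [ring | lia].
Qed.

Let entry i j x := wnorm i / wnorm j * wcoef j (l.*2 - j) i x.

Let sum_delta (F : nat -> R) n t :
  \sum_(k < n) F k * (k == t :> nat)%:R = if (t < n)%N then F t else 0.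
Proof.
case: ltnP => tn; last first.
  by rewrite big1 // => k _; rewrite ltn_eqF ?mulr0// (leq_trans _ tn).
rewrite (bigD1 (Ordinal tn)) //= eqxx mulr1 big1 ?addr0// => k kt.
by rewrite (_ : (k == t :> nat) = false) ?mulr0//; apply/negbTE: kt.
Qed.

Let entry0 i j : entry i j 0 = (i == j)%:R.
Proof.
rewrite /entry /wcoef /wpoly /rotU /rotV mul0r cos0 sin0 oppr0 mul0r mul1r add0r addr0.
rewrite expr1n mulr1 coefXn; case: eqVneq => [->|]; last by rewrite mulr0.
by rewrite mulr1 divff// gt_eqF// wnorm_gt0.
Qed.

Let entry_derive i j x : (j <= l.*2)%N -> is_derive x 1 (entry i j)
  (\sum_(k < l.*2.+1) entry i k x *
    (- 2^-1 * (Num.sqrt k%:R * Num.sqrt (l.*2 - k).+1%:R) * (k == j.+1 :> nat)%:R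
     + 2^-1 * (Num.sqrt (l.*2 - k)%:R * Num.sqrt k.+1%:R) * (k.+1 == j :> nat)%:R)).
Proof.
move=> jl.
have := is_derive_prod (is_derive_cst (wnorm i / wnorm j) x 1) (wcoef_derive j (l.*2 - j) i x).
rewrite mul0r add0r => d; apply: (is_derive_eq (d : is_derive x 1 (entry i j) _)); apply/esym.
have split_entry (k : nat) : entry i k x *
    (- 2^-1 * (Num.sqrt k%:R * Num.sqrt (l.*2 - k).+1%:R) * (k == j.+1 :> nat)%:R
     + 2^-1 * (Num.sqrt (l.*2 - k)%:R * Num.sqrt k.+1%:R) * (k.+1 == j :> nat)%:R)
  = - (2^-1 * entry i k x * (Num.sqrt k%:R * Num.sqrt (l.*2 - k).+1%:R)) * (k == j.+1 :> nat)%:R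
    + (if j is 0 then 0 else 2^-1 * entry i k x *
         (Num.sqrt (l.*2 - k)%:R * Num.sqrt k.+1%:R)) * (k == j.-1 :> nat)%:R.
  by case: j {jl d} => [|j] /=; rewrite ?eqSS; ring.
under eq_bigr do rewrite split_entry.
rewrite big_split /=.
rewrite (sum_delta (fun k => - (2^-1 * entry i k x *
  (Num.sqrt k%:R * Num.sqrt (l.*2 - k).+1%:R)))).
rewrite (sum_delta (fun k => if j is 0 then 0 else 2^-1 * entry i k x *
  (Num.sqrt (l.*2 - k)%:R * Num.sqrt k.+1%:R))).
rewrite ltnS (leq_ltn_trans (leq_pred j))// {split_entry}.
have sqr_sqrt k : Num.sqrt k%:R * Num.sqrt k%:R = k%:R :> R by rewrite -expr2 sqr_sqrtr.
have up : (if (j < l.*2)%N then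
    - (2^-1 * entry i j.+1 x * (Num.sqrt j.+1%:R * Num.sqrt (l.*2 - j.+1).+1%:R)) else 0)
   = - (wnorm i / wnorm j * (2^-1 * ((l.*2 - j)%:R * wcoef j.+1 (l.*2 - j).-1 i x))).
  case: ltnP => [jl'|lj]; last by rewrite (_ : l.*2 - j = 0)%N; [ring | lia].
  rewrite /entry subnS prednK ?subn_gt0// -[in RHS](sqr_sqrt (l.*2 - j)%N).
  have := wnormS jl'; have := wnorm_gt0 j; have := wnorm_gt0 j.+1.
  move=> /lt0r_neq0 ? /lt0r_neq0 ? E.
  have -> : Num.sqrt j.+1%:R = wnorm j.+1 * Num.sqrt (l.*2 - j)%:R / wnorm j.
    by rewrite E; field.
  by field; apply/andP; split.
rewrite up mulrBr mulrBr addrC; congr (_ + _).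
case: j jl {up d} => [|j] jl /=; first ring.
rewrite /entry -[in RHS](sqr_sqrt j.+1).
have := wnormS jl; have := wnorm_gt0 j; have := wnorm_gt0 j.+1.
move=> /lt0r_neq0 ? /lt0r_neq0 ? E.
rewrite (_ : (l.*2 - j.+1).+1 = l.*2 - j)%N; last by lia.
have -> : Num.sqrt (l.*2 - j)%:R = wnorm j * Num.sqrt j.+1%:R / wnorm j.+1.
  by rewrite -E; field.
by field; apply/andP; split.
Qed.

(** The right-hand side is the identity at 0 and its derivative is its product with
    [wigner_gen R l]: rescaling by [wnorm] turns the integer factors [j] and
    [2 l - j] of [wcoef_derive] into the square roots of the generator. *)
Lemma wigner_dE x (i j : 'I_(l.*2.+1)) :
  wigner_d l x i j = wnorm i / wnorm j * wcoef j (l.*2 - j) i x.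
Proof.
pose M y : 'M[R]_(l.*2.+1) := \matrix_(i, j) entry i j y.
rewrite /wigner_d -(@mexp_ode _ _ _ M).
- by rewrite mxE.
- by apply/matrixP => p q; rewrite !mxE entry0.
- move=> y p q; apply: is_derive_ext (fun z => esym (mxE _ _ _ _)) _.
  rewrite mxE; under eq_bigr do rewrite mxE wigner_genE.
  by apply: entry_derive; rewrite -ltnS.
Qed.

(** The generator is skew-symmetric, so [wigner_d] is orthogonal. *)
Lemma wigner_d_row_norm x (i : 'I_(l.*2.+1)) :
  \sum_j wigner_d l x i j ^+ 2 = 1.
Proof.
have := congr1 (fun M : 'M[R]_(l.*2.+1) => M i i) (mexp_orthogonal x wigner_gen_skew).
by rewrite !mxE eqxx mulr1n => <-; apply: eq_bigr => j _; rewrite mxE expr2.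
Qed.

End WignerD.

(** * Quadrature in the polar angle *)

Section Quadrature.
Variable R : realType.

Section CosSpan.
Implicit Types (N : nat) (g h : R -> R).

(** Even trigonometric polynomials of degree at most [N], kept as explicit sums of
    cosines because the quadrature is evaluated cosine by cosine. *)
Definition cos_span N g :=
  exists c : nat -> R, forall x, g x = \sum_(r < N.+1) c r * cos (r%:R * x).

Lemma cos_span_ext N g h : g =1 h -> cos_span N g -> cos_span N h.
Proof. by move=> gh [c E]; exists c => x; rewrite -gh. Qed.

Lemma cos_spanD N g h : cos_span N g -> cos_span N h -> cos_span N (fun x => g x + h x).
Proof.
move=> [c gE] [d hE]; exists (fun r => c r + d r) => x.
by rewrite gE hE -big_split /=; apply: eq_bigr => r _; rewrite mulrDl.
Qed.

Lemma cos_spanZ N g (e : R) : cos_span N g -> cos_span N (fun x => e * g x).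
Proof.
move=> [c gE]; exists (fun r => e * c r) => x.
by rewrite gE mulr_sumr; apply: eq_bigr => r _; rewrite mulrA.
Qed.

Lemma cos_span_sum (I : Type) (s : seq I) (F : I -> R -> R) N :
  (forall i, cos_span N (F i)) -> cos_span N (fun x => \sum_(i <- s) F i x).
Proof.
move=> sF; elim: s => [|i s IHs].
  exists (fun=> 0) => x; rewrite big_nil big1 // => r _; exact: mul0r.
by apply: cos_span_ext (cos_spanD (sF i) IHs) => x; rewrite big_cons.
Qed.

Lemma cos_span_cos N r : (r <= N)%N -> cos_span N (fun x => cos (r%:R * x)).
Proof.
move=> rN; exists (fun q => (q == r)%:R) => x.
rewrite (bigD1 (Ordinal (rN : (r < N.+1)%N))) //= eqxx mul1r big1 ?addr0 // => q qr.
by rewrite (_ : (q == r :> nat) = false) ?mul0r//; apply/negbTE: qr.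
Qed.

Lemma cos_spanS N g : cos_span N g -> cos_span N.+1 g.
Proof.
move=> [c gE]; apply: cos_span_ext (fun x => esym (gE x)) _.
by apply: cos_span_sum => r; apply/cos_spanZ/cos_span_cos; rewrite ltnW.
Qed.

Lemma cos_span_le M N g : (M <= N)%N -> cos_span M g -> cos_span N g.
Proof.
move=> MN sg; rewrite -(subnK MN); elim: (N - M)%N => //= d IHd.
by rewrite addSn; exact: cos_spanS.
Qed.

Lemma cos_spanM_cos N g : cos_span N g -> cos_span N.+1 (fun x => cos x * g x).
Proof.
move=> [c gE]; apply: (@cos_span_ext _
    (fun x => \sum_(r < N.+1) c r * (cos x * cos (r%:R * x)))) => [x|].
  by rewrite gE mulr_sumr; apply: eq_bigr => r _; rewrite mulrCA.
apply: cos_span_sum => -[r rN]; apply: cos_spanZ => /=.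
case: r rN => [|r] rN.
  apply: cos_span_ext (@cos_span_cos _ 1 _) => // x.
  by rewrite mul1r mul0r cos0 mulr1.
have s1 : cos_span N.+1 (fun x => 2^-1 * cos (r.+2%:R * x)).
  exact/cos_spanZ/cos_span_cos.
have s2 : cos_span N.+1 (fun x => 2^-1 * cos (r%:R * x)).
  by apply/cos_spanZ/cos_span_cos; lia.
apply: cos_span_ext (cos_spanD s1 s2) => x.
rewrite (_ : r.+2%:R * x = r.+1%:R * x + x); last by rewrite -(@natr1 _ r.+1); ring.
rewrite (_ : r%:R * x = r.+1%:R * x - x); last by rewrite -(@natr1 _ r); ring.
by rewrite cosD cosB; field.
Qed.

Let sq_half (x : R) :
  cos (x / 2) ^+ 2 = 2^-1 + 2^-1 * cos x /\ sin (x / 2) ^+ 2 = 2^-1 - 2^-1 * cos x.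
Proof. by rewrite (cos_half x); have := cos2Dsin2 (x / 2); split; lra. Qed.

(** Monomials of even exponents are polynomials in
    [cos (x / 2) ^+ 2 = (1 + cos x) / 2] and [sin (x / 2) ^+ 2 = (1 - cos x) / 2]. *)
Lemma cos_span_half M p q : (p + q = M.*2)%N -> ~~ odd q ->
  cos_span M (fun x => cos (x / 2) ^+ p * sin (x / 2) ^+ q).
Proof.
elim: M p q => [|M IHM] p q pq qe.
  have [-> ->] : p = 0%N /\ q = 0%N by lia.
  by exists (fun=> 1) => x; rewrite big_ord_recl big_ord0 mul0r cos0 !expr0; ring.
case: q pq qe => [|[|q]] // pq qe.
  case: p pq => [|[|p]] //= pq; have {}pq : (p + 0 = M.*2)%N by lia.
  have sp := IHM p 0%N pq isT.
  apply: cos_span_ext (cos_spanD (cos_spanZ 2^-1 (cos_spanS sp))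
    (cos_spanZ 2^-1 (cos_spanM_cos sp))) => x.
  by rewrite -[p.+2]addn2 exprD (sq_half x).1; ring.
have {}pq : (p + q = M.*2)%N by lia.
have sp := IHM p q pq (ltac:(by rewrite /= negbK in qe)).
apply: cos_span_ext (cos_spanD (cos_spanZ 2^-1 (cos_spanS sp))
  (cos_spanZ (- 2^-1) (cos_spanM_cos sp))) => x.
by rewrite -[q.+2]addn2 exprD (sq_half x).2; ring.
Qed.

End CosSpan.

Lemma coef_linX (p q : R) n i :
  ((p%:P * 'X + q%:P) ^+ n)`_i = 'C(n, i)%:R * (p ^+ i * q ^+ (n - i)).
Proof.
rewrite addrC exprDn coef_sum.
have -> : \sum_(j < n.+1) (q%:P ^+ (n - j) * (p%:P * 'X) ^+ j *+ 'C(n, j))`_i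
  = \sum_(j < n.+1) 'C(n, j)%:R * (p ^+ j * q ^+ (n - j)) * (j == i :> nat)%:R.
  apply: eq_bigr => j _; rewrite exprMn -!polyC_exp coefMn !coefCM coefXn eq_sym.
  by rewrite -mulr_natl; ring.
case: (ltnP i n.+1) => ni; last first.
  rewrite bin_small // mul0r big1 // => j _.
  by rewrite ltn_eqF ?mulr0 // (leq_trans _ ni).
rewrite (bigD1 (Ordinal ni)) //= eqxx mulr1 big1 ?addr0 // => j ji.
by rewrite (_ : (j == i :> nat) = false) ?mulr0//; apply/negbTE: ji.
Qed.

(** All terms have total degree [a + b] in the half-angle cosine and sine, and the
    exponents of the sine all have the parity of [a + k]: this is what
    [wcoef_prod_span] needs. *)
Lemma wcoef_monomials a b k x : wcoef a b k x =
  \sum_(i < k.+1) 'C(a, i)%:R * 'C(b, k - i)%:R * (-1) ^+ (k - i) *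
    (cos (x / 2) ^+ (i + (b - (k - i))) * sin (x / 2) ^+ (a - i + (k - i))) :> R.
Proof.
rewrite /wcoef /wpoly coefM; apply: eq_bigr => i _.
rewrite /rotU /rotV -polyCN !coef_linX !exprD (exprNn (sin (x / 2))); ring.
Qed.

(** The factor [sin x = 2 cos (x / 2) sin (x / 2)] makes all exponents of the
    half-angle functions even; the total degree is [2 M + 2]. *)
Lemma wcoef_prod_span a b k a' b' k' M : (a + b + (a' + b') = M.*2)%N ->
  odd (a + k + (a' + k')) ->
  cos_span M.+1 (fun x => wcoef a b k x * wcoef a' b' k' x * sin x : R).
Proof.
move=> abM odd_s.
(* A monomial with a truncated exponent has a vanishing binomial coefficient. *)
apply: (@cos_span_ext _ (fun x => \sum_(i < k.+1) \sum_(j < k'.+1)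
   ('C(a, i)%:R * 'C(b, k - i)%:R * (-1) ^+ (k - i) *
    ('C(a', j)%:R * 'C(b', k' - j)%:R * (-1) ^+ (k' - j)) * 2) *
   (cos (x / 2) ^+ (i + (b - (k - i)) + (j + (b' - (k' - j))) + 1) *
    sin (x / 2) ^+ (a - i + (k - i) + (a' - j + (k' - j)) + 1)))) => [x|].
  rewrite !wcoef_monomials mulr_suml mulr_suml; apply: eq_bigr => i _.
  rewrite mulr_sumr mulr_suml; apply: eq_bigr => j _.
  by rewrite (sin_half x) !exprD !expr1; ring.
apply: cos_span_sum => i; apply: cos_span_sum => j.
have triv (e : R) p : e = 0 -> cos_span M.+1 (fun x => e * p x).
  move=> ->; exists (fun=> 0) => x; rewrite mul0r big1 // => r _; exact: mul0r.
have [ai|ia] := ltnP a i; first by apply: triv; rewrite (bin_small ai); ring.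
have [bi|ib] := ltnP b (k - i); first by apply: triv; rewrite (bin_small bi); ring.
have [aj|ja] := ltnP a' j; first by apply: triv; rewrite (bin_small aj); ring.
have [bj|jb] := ltnP b' (k' - j); first by apply: triv; rewrite (bin_small bj); ring.
have := ltn_ord i; have := ltn_ord j.
by move=> ? ?; apply/cos_spanZ/cos_span_half; lia.
Qed.

Section Grid.
Variable B : nat.
Hypothesis B_gt0 : (0 < B)%N.

Let BR0 : B%:R != 0 :> R.
Proof. by rewrite pnatr_eq0 -lt0n. Qed.

Lemma grid_beta_itv k : (k < B.*2)%N -> 0 < grid_beta R B k < pi.
Proof.
move=> kB; have p0 := pi_gt0 R; have B0 : 0 < B%:R :> R by rewrite ltr0n.
rewrite /grid_beta; apply/andP; split.
  by rewrite divr_gt0 ?mulr_gt0 ?ltr0n.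
rewrite ltr_pdivrMr ?mulr_gt0// ltr_pM2l// -natrM ltr_nat; lia.
Qed.

Lemma sin_grid_beta_neq0 k : (k < B.*2)%N -> sin (grid_beta R B k) != 0.
Proof. by move=> /grid_beta_itv kB; rewrite gt_eqF// sin_gt0_pi. Qed.

Lemma cos_natpi n : cos (n%:R * pi) = (-1) ^+ n :> R.
Proof.
elim: n => [|n IHn]; first by rewrite mul0r cos0 expr0.
by rewrite -natr1 mulrDl mul1r cosDpi IHn exprS mulN1r.
Qed.

Lemma sin_natpi n : sin (n%:R * pi) = 0 :> R.
Proof.
elim: n => [|n IHn]; first by rewrite mul0r sin0.
by rewrite -natr1 mulrDl mul1r sinDpi IHn oppr0.
Qed.

(** With [t = s pi / (4 B)], the product of [2 sin t] with the k-th term is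
    [sin ((2 k + 2) t) - sin (2 k t)], and the sum telescopes to
    [sin (s pi) - sin 0 = 0], while [sin t] is not zero. *)
Lemma sum_cos_grid s : (0 < s < 4 * B)%N ->
  \sum_(k < B.*2) cos (s%:R * grid_beta R B k) = 0.
Proof.
case/andP=> s0 sB; pose t : R := s%:R * pi / (4 * B%:R).
have p0 := pi_gt0 R; have B0 : 0 < B%:R :> R by rewrite ltr0n.
have st : sin t != 0.
  rewrite gt_eqF// sin_gt0_pi// /t; apply/andP; split.
    by rewrite divr_gt0 ?mulr_gt0 ?ltr0n.
  by rewrite ltr_pdivrMr ?mulr_gt0// mulrC ltr_pM2l// -natrM ltr_nat.
apply: (mulfI st); rewrite mulr0 mulr_sumr.
rewrite (eq_bigr (fun k : 'I__ => 2^-1 * (sin (t * k.+1.*2%:R) - sin (t * k.*2%:R)))).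
  rewrite -mulr_sumr -(big_mkord xpredT (fun k => sin (t * k.+1.*2%:R) - sin (t * k.*2%:R))).
  rewrite telescope_sumr // double0 mulr0 sin0 subr0.
  rewrite (_ : t * _ = s%:R * pi) ?sin_natpi ?mulr0// /t -!muln2 !natrM; field.
  exact: BR0.
move=> k _; have -> : s%:R * grid_beta R B k = t * k.*2.+1%:R.
  by rewrite /grid_beta /t; field.
rewrite (_ : t * k.+1.*2%:R = t * k.*2.+1%:R + t); last first.
  by rewrite doubleS -(@natr1 _ k.*2.+1); ring.
rewrite (_ : t * k.*2%:R = t * k.*2.+1%:R - t); last by rewrite -(@natr1 _ k.*2); ring.
by rewrite sinD sinB; field.
Qed.

(** Product-to-sum reduces this to [sum_cos_grid]. The value [r = 2 B] is allowed, as
    [s + r] stays below [4 B]. *)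
Lemma sum_sin_grid s r : (0 < s < B.*2)%N -> (r <= B.*2)%N ->
  \sum_(k < B.*2) sin (s%:R * grid_beta R B k) * sin (r%:R * grid_beta R B k)
  = B%:R * (r == s)%:R.
Proof.
case/andP=> s0 sB rB.
case: r rB => [|r] rB.
  rewrite (_ : (0 == s)%N = false) ?mulr0; last by lia.
  by rewrite big1 // => k _; rewrite mul0r sin0 mulr0.
(* The difference of the frequencies is taken in the order that keeps it natural. *)
rewrite (eq_bigr (fun k : 'I__ => 2^-1 * (cos ((maxn s r.+1 - minn s r.+1)%:R * grid_beta R B k)
    - cos ((s + r.+1)%:R * grid_beta R B k)))); last first.
  move=> k _; have -> : cos ((maxn s r.+1 - minn s r.+1)%:R * grid_beta R B k) =
      cos (s%:R * grid_beta R B k - r.+1%:R * grid_beta R B k).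
    case: (leqP s r.+1) => [sr|/ltnW sr]; rewrite (natrB _ sr) mulrBl //.
    by rewrite -cosN opprB.
  by rewrite natrD mulrDl cosB cosD; field.
rewrite -mulr_sumr sumrB (sum_cos_grid (s := s + r.+1)) ?subr0; last by lia.
case: eqVneq => [->|rs].
  rewrite maxnn minnn subnn (eq_bigr (fun=> 1)) => [|k _]; last by rewrite mul0r cos0.
  by rewrite sumr_const card_ord -muln2 natrM mulr1n; field.
by rewrite sum_cos_grid ?mulr0//; lia.
Qed.

Let sum_odd (F : nat -> R) :
  \sum_(r < B.*2.+1) F r * (odd r)%:R = \sum_(j < B) F j.*2.+1.
Proof.
elim: B => [|n IHn]; first by rewrite big_ord_recl !big_ord0 mulr0 addr0.
rewrite doubleS 2!big_ord_recr /= IHn big_ord_recr /= odd_double /=.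
by rewrite mulr1 mulr0 addr0.
Qed.

(** Fundamental theorem of calculus for the quadrature: up to the factor [4 B ^+ 2],
    the weights integrate [G' / sin] against [sin / 2] exactly. For
    [G = cos (r x)], the factor [sin (grid_beta R B k)] of the weight cancels, and
    discrete orthogonality of the sines picks from the sum defining the weight the
    term of frequency [r]; it is present exactly when [r] is odd, and then its
    coefficient [1 / r] cancels the factor [r] of the derivative. For [r] even,
    [G pi = G 0]. *)
Lemma grid_quadrature_derive (G : R -> R) (dG : nat -> R) :
  cos_span B.*2 G ->
  (forall k, (k < B.*2)%N -> is_derive (grid_beta R B k) 1 G (dG k)) ->
  \sum_(k < B.*2) grid_weight R B k * (dG k / sin (grid_beta R B k)) =
    (G pi - G 0) / (8 * B%:R ^+ 2).
Proof.
move=> [c GE] dGE.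
have dGk (k : 'I_(B.*2)) : dG k = - \sum_(r < B.*2.+1) c r * r%:R * sin (r%:R * grid_beta R B k).
  set x := grid_beta R B k.
  have dx : is_derive x 1 G (\sum_(r < B.*2.+1) (0 * cos (r%:R * x) +
      c r * (- sin (r%:R * x) * (0 * x + r%:R * 1)))).
    rewrite (funext GE); apply: is_derive_big => r.
    apply: (@is_derive_prod R (fun=> c r) (fun y => cos (r%:R * y))).
    apply: (@is_derive1_comp R cos (fun y => r%:R * y)).
    exact: (@is_derive_prod R (fun=> r%:R) id).
  rewrite -(@derive_val _ _ _ _ _ _ _ (dGE k (ltn_ord k))) (@derive_val _ _ _ _ _ _ _ dx).
  by rewrite -sumrN; apply: eq_bigr => r _; ring.
transitivity (- (4 * B%:R ^+ 3)^-1 * \sum_(j < B) \sum_(r < B.*2.+1)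
   (j.*2.+1)%:R^-1 * (c r * r%:R) * (B%:R * (r == j.*2.+1 :> nat)%:R)).
  transitivity (- (4 * B%:R ^+ 3)^-1 * \sum_(k < B.*2) \sum_(j < B) \sum_(r < B.*2.+1)
     (j.*2.+1)%:R^-1 * (c r * r%:R) *
     (sin (j.*2.+1%:R * grid_beta R B k) * sin (r%:R * grid_beta R B k))).
    rewrite mulr_sumr; apply: eq_bigr => k _; rewrite dGk /grid_weight.
    have sk := sin_grid_beta_neq0 (ltn_ord k).
    transitivity (- (4 * B%:R ^+ 3)^-1 *
      ((\sum_(j < B) 1 / (j.*2.+1)%:R * sin ((j.*2.+1)%:R * grid_beta R B k)) *
       \sum_(r < B.*2.+1) c r * r%:R * sin (r%:R * grid_beta R B k))).
      by field; rewrite sk BR0.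
    congr (_ * _); rewrite mulr_suml; apply: eq_bigr => j _.
    by rewrite mulr_sumr; apply: eq_bigr => r _; ring.
  congr (_ * _); rewrite exchange_big /=; apply: eq_bigr => j _.
  rewrite exchange_big /=; apply: eq_bigr => r _; rewrite -mulr_sumr sum_sin_grid//.
    by have := ltn_ord j; lia.
  by rewrite -ltnS.
have -> : G pi - G 0 = - 2 * \sum_(j < B) c j.*2.+1.
  rewrite -sum_odd !GE -sumrB mulr_sumr; apply: eq_bigr => r _.
  rewrite cos_natpi mulr0 cos0 -signr_odd; case: odd => /=.
    by rewrite expr1; ring.
  by rewrite expr0; ring.
have -> : \sum_(j < B) \sum_(r < B.*2.+1)
   (j.*2.+1)%:R^-1 * (c r * r%:R) * (B%:R * (r == j.*2.+1 :> nat)%:R)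
   = B%:R * \sum_(j < B) c j.*2.+1.
  rewrite mulr_sumr; apply: eq_bigr => j _.
  have jB : (j.*2.+1 < B.*2.+1)%N by have := ltn_ord j; lia.
  rewrite (bigD1 (Ordinal jB)) //= eqxx big1 ?addr0 => [|r rj].
    by rewrite mulr1n mulr1 [c _ * _]mulrC mulKf ?pnatr_eq0 // mulrC.
  by rewrite (_ : (r == j.*2.+1 :> nat) = false) ?mulr0//; apply/negbTE: rj.
by field.
Qed.

End Grid.
End Quadrature.

(** * Orthogonality of the Wigner d-functions on the polar grid *)

Section GridOrthogonality.
Variable R : realType.
Variable B : nat.
Hypothesis B_gt0 : (0 < B)%N.

(** Quadrature counterpart of half the integral against [sin] over [0, pi], divided
    by [4 B ^+ 2]. *)
Definition polar_sum (g : R -> R) : R :=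
  \sum_(k < B.*2) grid_weight R B k * g (grid_beta R B k).

(** Integration by parts. With [n = a - l] the columns on the two sides are [n + 1] and
    [n]. The derivative of [G = u v sin], with [u] the column [n] of degree [l] and
    [v] the column [n + 1] of degree [l'], divided by [sin], is the difference of
    the two integrands: the terms containing [u v] have the factors
    [- (m - n cos)], [m - (n + 1) cos] and [cos], which add up to zero. As [G]
    vanishes at 0 and [pi], its quadrature is zero. The predecessors are truncated
    at 0, where the factors [b] and [a'] vanish. *)
Lemma polar_sum_ladder l l' a b a' b' k k' :
  (a + b = l.*2)%N -> (a' + b' = l'.*2)%N -> (a' + l = a.+1 + l')%N ->
  (k + l' = k' + l)%N -> (l + l' < B.*2)%N ->
  b%:R * polar_sum (fun x => wcoef a.+1 b.-1 k x * wcoef a' b' k' x) =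
  a'%:R * polar_sum (fun x => wcoef a b k x * wcoef a'.-1 b'.+1 k' x).
Proof.
move=> ab ab' aa' kk' llB.
pose u := @wcoef R a b k; pose v := @wcoef R a' b' k'.
pose up := @wcoef R a.+1 b.-1 k; pose vm := @wcoef R a'.-1 b'.+1 k'.
pose um := @wcoef R a.-1 b.+1 k; pose vp := @wcoef R a'.+1 b'.-1 k'.
pose dG x := (2^-1 * (a%:R * um x - b%:R * up x) * v x
  + u x * (2^-1 * (a'%:R * vm x - b'%:R * vp x))) * sin x + u x * v x * cos x.
have dGE (x : R) : is_derive x 1 (fun x => u x * v x * sin x) (dG x).
  apply: (@is_derive_prod R (fun x => u x * v x) sin).
  by apply: is_derive_prod; exact: wcoef_derive.
have spanG : cos_span B.*2 (fun x => u x * v x * sin x).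
  by apply: (cos_span_le llB); apply: wcoef_prod_span; lia.
have := grid_quadrature_derive B_gt0 spanG (fun k _ => dGE (grid_beta R B k)).
rewrite sinpi sin0 !mulr0 subrr mul0r => Q0.
apply/eqP; rewrite eq_sym -subr_eq0 -[X in _ == X]Q0; apply/eqP.
rewrite /polar_sum !mulr_sumr -sumrB; apply: eq_bigr => t _.
set x := grid_beta R B t.
have sx : sin x != 0 by exact: sin_grid_beta_neq0.
have eu := wcoef_degree_relation a b k x; have ev := wcoef_degree_relation a' b' k' x.
rewrite -/(u x) -/(um x) -/(up x) -/(v x) -/(vm x) -/(vp x) in eu ev *.
have castD p q r s : (p + q = r + s)%N -> p%:R + q%:R = r%:R + s%:R :> R.
  by rewrite -!natrD => ->.
have bE : b%:R = l%:R + l%:R - a%:R :> R.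
  by have := castD a b l l; rewrite addnn => /(_ ab); lra.
have bE' : b'%:R = l'%:R + l'%:R - a'%:R :> R.
  by have := castD a' b' l' l'; rewrite addnn => /(_ ab'); lra.
have aE' : a'%:R = a%:R + 1 + l'%:R - l%:R :> R.
  by have := castD _ _ _ _ aa'; rewrite -natr1; lra.
have kE' : k'%:R = k%:R + l'%:R - l%:R :> R by have := castD _ _ _ _ kk'; lra.
(* The common row label and the column label of [u]; that of [v] is [n + 1]. *)
pose m : R := k%:R - l%:R; pose n : R := a%:R - l%:R.
have du : sin x * (2^-1 * (a%:R * um x - b%:R * up x)) =
    - (m - n * cos x) * u x - sin x * (b%:R * up x).
  move: eu; rewrite natrD bE (_ : _ - _ - _ = m - n * cos x); last by rewrite /m /n; field.
  by move=> E; rewrite mulNr E; field.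
have dv : sin x * (2^-1 * (a'%:R * vm x - b'%:R * vp x)) =
    (m - (n + 1) * cos x) * v x + sin x * (a'%:R * vm x).
  move: ev; rewrite natrD bE' kE' (_ : _ - _ - _ = m - (n + 1) * cos x); last first.
    by rewrite aE' /m /n; field.
  by move=> ->; field.
rewrite (_ : dG x = (sin x * (2^-1 * (a%:R * um x - b%:R * up x))) * v x
  + u x * (sin x * (2^-1 * (a'%:R * vm x - b'%:R * vp x))) + u x * v x * cos x);
  last by rewrite /dG; ring.
by rewrite du dv; field.
Qed.

Lemma polar_sum1 : polar_sum (fun=> 1) = (4 * B%:R ^+ 2)^-1.
Proof.
have B0 : B%:R != 0 :> R by rewrite pnatr_eq0 -lt0n.
(* [- cos] is the primitive of [sin]. *)
have span_cos : cos_span B.*2 (fun x : R => -1 * cos x).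
  apply: cos_spanZ; apply: cos_span_ext (@cos_span_cos R B.*2 1 _); last by lia.
  by move=> x; rewrite mul1r.
have d (k : nat) : (k < B.*2)%N ->
    is_derive (grid_beta R B k) 1 (fun x => -1 * cos x) (sin (grid_beta R B k)).
  move=> _; have := @is_derive_prod R (fun=> -1) cos (grid_beta R B k) 0 _
    (is_derive_cst _ _ _) (is_derive_cos _).
  by rewrite mul0r add0r mulN1r opprK.
have := grid_quadrature_derive B_gt0 span_cos d.
rewrite cospi cos0 => E; transitivity ((-1 * -1 - -1 * 1) / (8 * B%:R ^+ 2) : R).
  rewrite -E; apply: eq_bigr => k _.
  by rewrite divff// sin_grid_beta_neq0.
by field.
Qed.

Let polar_sum_wigner l l' (i j : 'I_(l.*2.+1)) (i' j' : 'I_(l'.*2.+1)) :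
  polar_sum (fun x => wigner_d l x i j * wigner_d l' x i' j') =
  (wnorm R l i / wnorm R l j) * (wnorm R l' i' / wnorm R l' j') *
  polar_sum (fun x => wcoef j (l.*2 - j) i x * wcoef j' (l'.*2 - j') i' x).
Proof.
rewrite /polar_sum mulr_sumr; apply: eq_bigr => k _; rewrite !wigner_dE; ring.
Qed.

Let polar_sum_wcoef_lt l l' i i' j' : (l < B)%N -> (l' < l)%N ->
  (i + l' = i' + l)%N -> (j' <= l'.*2)%N ->
  polar_sum (fun x => wcoef (j' + (l - l')) (l.*2 - (j' + (l - l'))) i x
                  * wcoef j' (l'.*2 - j') i' x) = 0.
Proof.
move=> lB ll ii; elim: j' => [|j IHj] jl.
  have := @polar_sum_ladder l l' (l - l').-1 (l.*2 - (l - l')).+1 0 l'.*2 i i'.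
  rewrite mul0r add0n subn0 prednK; last by lia.
  move=> /(_ _ _ _ _ _)/eqP; rewrite mulf_eq0 pnatr_eq0 /= => H.
  by apply/eqP/H; lia.
have := @polar_sum_ladder l l' (j + (l - l')) (l.*2 - (j + (l - l'))) j.+1 (l'.*2 - j.+1) i i'.
rewrite /= (_ : (l'.*2 - j.+1).+1 = l'.*2 - j)%N; last by lia.
rewrite IHj ?mulr0; last by lia.
move=> /(_ _ _ _ _ _)/eqP; rewrite mulf_eq0 pnatr_eq0 -subnS => H.
by apply/eqP; have /orP[] := H ltac:(lia) ltac:(lia) ltac:(lia) ltac:(lia) ltac:(lia);
  [lia | rewrite addSn].
Qed.

Let polar_sum_diag_step l (i : 'I_(l.*2.+1)) j (jl : (j < l.*2.+1)%N) (jl' : (j.+1 < l.*2.+1)%N) :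
  (l < B)%N ->
  polar_sum (fun x => wigner_d l x i (Ordinal jl') * wigner_d l x i (Ordinal jl')) =
  polar_sum (fun x => wigner_d l x i (Ordinal jl) * wigner_d l x i (Ordinal jl)).
Proof.
move=> lB; rewrite !polar_sum_wigner /=.
have := @polar_sum_ladder l l j (l.*2 - j) j.+1 (l.*2 - j.+1) i i.
rewrite /= -subnS (_ : (l.*2 - j.+1).+1 = l.*2 - j)%N; last by lia.
move=> /(_ ltac:(lia) ltac:(lia) ltac:(lia) erefl ltac:(lia)).
move: (polar_sum _) (polar_sum _) => J J' E.
have W (p : nat) : wnorm R l p * wnorm R l p = (p`! * (l.*2 - p)`!)%:R.
  by rewrite -expr2 sqr_sqrtr.
have w0 p : wnorm R l p != 0 by rewrite gt_eqF// wnorm_gt0.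
have WW : wnorm R l j.+1 * wnorm R l j.+1 * (l.*2 - j)%:R
    = wnorm R l j * wnorm R l j * j.+1%:R.
  rewrite !W -!natrM; congr _%:R; have -> : (l.*2 - j = (l.*2 - j.+1).+1)%N by lia.
  by rewrite !factS; ring.
have b0 : (l.*2 - j)%:R != 0 :> R by rewrite pnatr_eq0; lia.
have -> : J' = j.+1%:R * J / (l.*2 - j)%:R by rewrite -E mulrC mulKf.
have -> : j.+1%:R = wnorm R l j.+1 * wnorm R l j.+1 * (l.*2 - j)%:R /
   (wnorm R l j * wnorm R l j) :> R.
  by rewrite WW mulrC mulKf // mulf_neq0.
by field; rewrite b0 !w0.
Qed.

Let polar_sum_diag l (i j : 'I_(l.*2.+1)) : (l < B)%N ->
  polar_sum (fun x => wigner_d l x i j * wigner_d l x i j) =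
  (4 * B%:R ^+ 2 * (l.*2.+1)%:R)^-1.
Proof.
move=> lB.
have cst (p : 'I_(l.*2.+1)) : polar_sum (fun x => wigner_d l x i p * wigner_d l x i p) =
    polar_sum (fun x => wigner_d l x i ord0 * wigner_d l x i ord0).
  case: p => p; elim: p => [|p IHp] pl.
    by rewrite (_ : Ordinal pl = ord0) //; exact: val_inj.
  by rewrite -(IHp (ltnW pl)); exact: polar_sum_diag_step.
have : \sum_p polar_sum (fun x => wigner_d l x i p * wigner_d l x i p) = (4 * B%:R ^+ 2)^-1.
  rewrite -polar_sum1 /polar_sum exchange_big /=; apply: eq_bigr => k _.
  rewrite -mulr_sumr; congr (_ * _).
  by rewrite -(wigner_d_row_norm (grid_beta R B k) i); apply: eq_bigr => p _; rewrite expr2.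
under eq_bigr do rewrite cst -(cst j).
rewrite sumr_const card_ord => E.
by rewrite invfM -E -[_ *+ _]mulr_natr mulfK// pnatr_eq0.
Qed.

(** For [l' < l] the ladder starts at the column [- l'] of degree [l'], where its
    right-hand side is zero, and carries this zero to all columns. For [l = l'] it
    says that the squared norm of [wigner_d l i j] does not depend on the column
    [j]; the [2 l + 1] norms add up to [polar_sum (fun=> 1)] by [wigner_d_row_norm]. *)
Lemma wigner_d_grid_orthogonal l l' (i j : 'I_(l.*2.+1)) (i' j' : 'I_(l'.*2.+1)) :
  (l < B)%N -> (l' < B)%N -> (i + l' = i' + l)%N -> (j + l' = j' + l)%N ->
  polar_sum (fun x => wigner_d l x i j * wigner_d l' x i' j') =
  if l == l' then (4 * B%:R ^+ 2 * (l.*2.+1)%:R)^-1 else 0.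
Proof.
have polar_sumC (g h : R -> R) : polar_sum (fun x => g x * h x) = polar_sum (fun x => h x * g x).
  by apply: eq_bigr => k _; rewrite [g _ * _]mulrC.
wlog ll : l l' i j i' j' / (l' <= l)%N => [hw|] lB lB' ii jj.
  case/orP: (leq_total l' l) => [|ll]; first by move=> ?; apply: hw.
  rewrite polar_sumC (hw _ _ i' j' i j) //.
  by rewrite eq_sym; case: eqP => [->|].
case: eqVneq ll => [ll _|ll].
  subst l'; have -> : i' = i by apply: val_inj => /=; lia.
  have -> : j' = j by apply: val_inj => /=; lia.
  exact: polar_sum_diag.
rewrite leq_eqVlt eq_sym (negbTE ll) /= => lt_ll.
have jE : (j : nat) = (j' + (l - l'))%N by lia.
by rewrite polar_sum_wigner jE polar_sum_wcoef_lt ?mulr0 // -ltnS.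
Qed.

End GridOrthogonality.

(** * Unitarity of the change to real harmonics *)

Section RealHarmonics.
Variable R : realType.
Local Open Scope complex_scope.

Lemma lbl_rev_ord l (i : 'I_(l.*2.+1)) : lbl (rev_ord i) = - lbl i.
Proof. by rewrite /lbl /=; have := ltn_ord i; lia. Qed.

Lemma lbl_eq l (i j : 'I_(l.*2.+1)) : (lbl i == lbl j) = (i == j).
Proof. by rewrite /lbl -val_eqE /=; lia. Qed.

Let conjM (x y : R[i]) : conjc (x * y) = conjc x * conjc y.
Proof. exact: rmorphM. Qed.

(** A row of [real_basis] is supported on the labels [m] and [- m]. *)
Lemma real_basis_row l (i : 'I_(l.*2.+1)) (c : 'I_(l.*2.+1) -> R[i]) :
  \sum_p real_basis R l i p * c p =
  if lbl i == 0 then c i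
  else real_basis R l i i * c i + real_basis R l i (rev_ord i) * c (rev_ord i).
Proof.
have off (p : 'I_(l.*2.+1)) : p != i -> p != rev_ord i -> real_basis R l i p = 0.
  rewrite -!lbl_eq lbl_rev_ord mxE /= => pi pr.
  rewrite (_ : (lbl i == 0) && (lbl p == 0) = false); last by lia.
  by rewrite (_ : `|lbl i| != `|lbl p|); last by lia.
case: eqVneq => i0.
  rewrite (bigD1 i) //= big1 ?addr0 => [|p pi].
    by rewrite mxE /= i0 eqxx mul1r.
  by rewrite off ?mul0r // -lbl_eq lbl_rev_ord i0 oppr0 -i0 lbl_eq.
rewrite (bigD1 i) //= (bigD1 (rev_ord i)) /=; last by rewrite -lbl_eq lbl_rev_ord; lia.
by rewrite big1 ?addr0 // => p /andP[pi pr]; rewrite off // mul0r.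
Qed.

Lemma real_basis_unitary l (i j : 'I_(l.*2.+1)) :
  \sum_p real_basis R l i p * conjc (real_basis R l j p) = (i == j)%:R.
Proof.
rewrite real_basis_row !mxE /= lbl_rev_ord -lbl_eq.
set m := lbl i; set n := lbl j.
set s := (Num.sqrt 2)%:C.
have s2 : s * s = 2 :> R[i].
  rewrite /s -[LHS](rmorphM (real_complex R)) -expr2 sqr_sqrtr // .
  exact: (rmorph_nat (real_complex R)).
have s0 : s != 0 by apply: contra_eq_neq s2 => ->; rewrite mul0r eq_sym pnatr_eq0.
have conj_i : conjc 'i = - 'i :> R[i].
  by apply/eqP; rewrite eq_complex /= oppr0 !eqxx.
have i2 : 'i * 'i = -1 :> R[i] by rewrite -expr2 sqr_i.
have signE (k : int) : (-1) ^ k = (-1) ^+ odd `|k| :> R[i].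
  case: k => k; first by rewrite -exprnP signr_odd.
  by rewrite NegzE -exprz_inv invrN1 -exprnP abszN signr_odd.
have signN : (-1) ^ (- m) = (-1) ^ m :> R[i] by rewrite !signE abszN.
pose e : R[i] := (-1) ^ m.
have e2 : e * e = 1 by rewrite /e signE -signr_addb addbb.
have conj_e : conjc e = e by rewrite /e signE rmorphXn rmorphN1.
have conjV (x : R[i]) : conjc (x / s) = conjc x / s.
  by rewrite conjM; congr (_ * _); rewrite /s conjc_inv conjc_real.
have half : s^-1 * s^-1 = 2^-1 by rewrite -invfM s2.
have conjN (x : R[i]) : conjc (- x) = - conjc x by exact: rmorphN.
have [m0|m0] := eqVneq m 0.
  have [n0|n0] := eqVneq n 0; first by rewrite m0 n0 eqxx; apply: conjc1.
  have ne : `|n| != `|m| by lia.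
  by rewrite /= (ifT _ _ ne) conjc0 m0 eq_sym (negbTE n0).
rewrite oppr_eq0 (negbTE m0) !andbF /= !normrN eqxx /=.
rewrite (_ : (- m == m) = false); last by lia.
have [mn|mn] := eqVneq m n.
  rewrite -mn !eqxx (_ : (- m == m) = false) /=; last by lia.
  case: ifP => _.
    rewrite !conjV -/e conj_e conjc1.
    transitivity ((e * e + 1) * (s^-1 * s^-1)); first by ring.
    by rewrite e2 half; field.
  rewrite !conjV conjM conjN conj_i -/e conj_e.
  transitivity (- ('i * 'i) * (1 + e * e) * (s^-1 * s^-1)); first by ring.
  by rewrite i2 e2 half; field.
(* Distinct rows overlap only if their labels are opposite; the two products that
   then occur cancel. *)
have [nm|nm] := eqVneq n (- m); last first.
  have ne : `|n| != `|m| by lia.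
  by rewrite !(ifT _ _ ne) conjc0 !mulr0 addr0.
rewrite nm normrN !eqxx /= oppr_gt0 signN -/e.
have [m_gt0|m_le0] := ltP 0 m.
  rewrite (_ : (m < 0) = false); last by lia.
  rewrite !conjV conjM conjN conj_i conj_e.
  transitivity ('i * (e * e - 1) * (s^-1 * s^-1)); first by ring.
  by rewrite e2; ring.
rewrite (_ : (m < 0) = true); last by lia.
rewrite !conjV conj_e conjc1.
transitivity ('i * (1 - e * e) * (s^-1 * s^-1)); first by ring.
by rewrite e2; ring.
Qed.

End RealHarmonics.

(** * Orthogonality of the real harmonics on the grid *)

Lemma exchange_big_triple (V : nmodType) (I J K L : finType) (X : L -> I -> J -> K -> V) :
  \sum_i \sum_j \sum_k \sum_t X t i j k = \sum_t \sum_i \sum_j \sum_k X t i j k.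
Proof.
rewrite [RHS]exchange_big /=; apply: eq_bigr => i _.
by rewrite [RHS]exchange_big /=; apply: eq_bigr => j _; rewrite [RHS]exchange_big.
Qed.

Section GridFunctional.
Variable R : realType.
Variable B : nat.
Hypothesis B_gt0 : (0 < B)%N.
Local Open Scope complex_scope.

Let conjM (x y : R[i]) : conjc (x * y) = conjc x * conjc y.
Proof. exact: rmorphM. Qed.

Let realM (x y : R) : (x * y)%:C = x%:C * y%:C :> R[i].
Proof. exact: rmorphM. Qed.

Lemma expiD (s t : R) : expi (s + t) = expi s * expi t.
Proof. by apply/eqP; rewrite /expi eq_complex /= sinD cosD; apply/andP; split; apply/eqP; ring. Qed.

Lemma conj_expi (t : R) : conjc (expi t) = expi (- t).
Proof. by rewrite /expi /= cosN sinN. Qed.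

Lemma expi_natM (t : R) n : expi (n%:R * t) = expi t ^+ n.
Proof.
elim: n => [|n IHn]; last by rewrite -natr1 mulrDl mul1r expiD IHn exprSr.
by rewrite mul0r expr0 /expi cos0 sin0.
Qed.

Lemma expi_eq1 (t : R) : 0 < `|t| < 2 * pi -> expi t != 1.
Proof.
move=> t2; apply/negP => /eqP[c1 s0].
have : `|t| = 0; last by move=> t0; rewrite t0 ltxx in t2.
apply: angle_inj; rewrite ?cos_norm ?c1 ?cos0 ?sin0 //.
- by case/andP: t2 => ? ->; rewrite normr_ge0.
- by rewrite lexx /= mulr_gt0 ?pi_gt0.
- by case: (ltrP t 0) => t0; [rewrite ltr0_norm// sinN s0 oppr0 | rewrite ger0_norm].
Qed.

(** For [d != 0], a geometric sum over all powers of a root of unity of order dividing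
    [2 B], different from 1 because [0 < `|d| < 2 B]. *)
Lemma sum_expi_grid (d : int) : `|d| < B.*2%:Z ->
  \sum_(j < B.*2) expi (d%:~R * grid_angle R B j) = B.*2%:R * (d == 0)%:R.
Proof.
move=> dB; have B0 : 0 < B%:R :> R by rewrite ltr0n.
case: eqVneq => [->|d0].
  rewrite (eq_bigr (fun=> 1)) => [|j _]; last by rewrite mul0r /expi cos0 sin0.
  by rewrite sumr_const card_ord mulr1n mulr1.
pose t : R := d%:~R * (pi / B%:R).
rewrite mulr0 (eq_bigr (fun j : 'I__ => expi t ^+ j)) => [|j _]; last first.
  by rewrite -expi_natM /t /grid_angle; congr expi; ring.
have t1 : expi t != 1.
  apply: expi_eq1; have p0 := pi_gt0 R.
  rewrite /t normrM (ger0_norm (ltW (divr_gt0 p0 B0))) -intr_norm; apply/andP; split.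
    by rewrite mulr_gt0 ?divr_gt0// ltr0z normr_gt0.
  rewrite mulrA ltr_pdivrMr// mulrAC ltr_pM2r//.
  by rewrite -natrM mul2n [ltRHS]pmulrn ltr_int.
apply: (mulfI (_ : expi t - 1 != 0)); first by rewrite subr_eq0.
rewrite mulr0 -subrX1 -expi_natM.
have -> : B.*2%:R * t = d%:~R * pi *+ 2.
  by rewrite /t -mul2n natrM -mulr_natr; field; rewrite gt_eqF.
apply/eqP; rewrite subr_eq0; apply/eqP.
have nat_case n : expi (n%:R * pi *+ 2) = 1 :> R[i].
  rewrite mulr2n expiD /expi cos_natpi sin_natpi; apply/eqP; rewrite eq_complex /=.
  by rewrite !mulr0 mul0r addr0 subr0 -expr2 sqrr_sign !eqxx.
case: d {dB d0 t t1} => n; first exact: nat_case.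
by rewrite NegzE mulrNz mulNr mulNrn -conj_expi nat_case conjc1.
Qed.

(** The right-hand side of the inversion formula, for complex integrands. *)
Definition grid_sum (g : R -> R -> R -> R[i]) : R[i] :=
  \sum_(j1 < B.*2) \sum_(j2 < B.*2) \sum_(k < B.*2) (grid_weight R B k)%:C *
    g (grid_angle R B j1) (grid_beta R B k) (grid_angle R B j2).

Lemma grid_sum_sum (I : finType) (g : I -> R -> R -> R -> R[i]) :
  grid_sum (fun x y z => \sum_i g i x y z) = \sum_i grid_sum (g i).
Proof.
rewrite -exchange_big_triple; apply: eq_bigr => j1 _; apply: eq_bigr => j2 _.
by apply: eq_bigr => k _; rewrite mulr_sumr.
Qed.

Lemma grid_sumZ c g : grid_sum (fun x y z => c * g x y z) = c * grid_sum g.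
Proof.
rewrite mulr_sumr; apply: eq_bigr => j1 _; rewrite mulr_sumr; apply: eq_bigr => j2 _.
by rewrite mulr_sumr; apply: eq_bigr => k _; rewrite mulrCA.
Qed.

Lemma eq_grid_sum g h : (forall (j1 j2 k : nat), (j1 < B.*2)%N -> (j2 < B.*2)%N -> (k < B.*2)%N ->
   g (grid_angle R B j1) (grid_beta R B k) (grid_angle R B j2) =
   h (grid_angle R B j1) (grid_beta R B k) (grid_angle R B j2)) -> grid_sum g = grid_sum h.
Proof.
move=> gh; apply: eq_bigr => j1 _; apply: eq_bigr => j2 _; apply: eq_bigr => k _.
by rewrite gh.
Qed.

(** The triple sum factors: the sums over the first and third angles are geometric
    and force equal labels, which leaves the polar sum. Bandwidth [B] enters
    through [`|lbl p - lbl p'| <= l + l' < 2 B]. *)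
Lemma wigner_grid_orthogonal l l' (p q : 'I_(l.*2.+1)) (p' q' : 'I_(l'.*2.+1)) :
  (l < B)%N -> (l' < B)%N ->
  grid_sum (fun x y z => conjc (wigner_euler l x y z p q) * wigner_euler l' x y z p' q')
  = ((l == l') && ((lbl p == lbl p') && (lbl q == lbl q')))%:R / (l.*2.+1)%:R.
Proof.
move=> lB lB'; have B0 : B%:R != 0 :> R by rewrite pnatr_eq0 -lt0n.
have expiB (d e : int) (t : R) :
    expi ((d - e)%:~R * t) = expi (d%:~R * t) * expi (- (e%:~R * t)).
  by rewrite rmorphB mulrBl expiD.
pose dd x := wigner_d l x p q * wigner_d l' x p' q' : R.
transitivity (B.*2%:R * (lbl p == lbl p')%:R * (B.*2%:R * (lbl q == lbl q')%:R) *
   (polar_sum B dd)%:C).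
  rewrite -(subr_eq0 (lbl p)) -(subr_eq0 (lbl q)) -!sum_expi_grid; first last.
  - by rewrite /lbl; have := ltn_ord p; have := ltn_ord p'; lia.
  - by rewrite /lbl; have := ltn_ord q; have := ltn_ord q'; lia.
  rewrite mulr_suml mulr_suml; apply: eq_bigr => j1 _.
  rewrite mulr_sumr mulr_suml; apply: eq_bigr => j2 _.
  rewrite /polar_sum (rmorph_sum (real_complex R)) mulr_sumr; apply: eq_bigr => k _ /=.
  rewrite !mxE !conjM !conj_expi conjc_real /dd !realM.
  by rewrite (expiB (lbl p)) (expiB (lbl q)) !opprK; ring.
case: (eqVneq (lbl p) (lbl p')) => pp; last by rewrite andbF mulr0 !mul0r.
case: (eqVneq (lbl q) (lbl q')) => qq; last by rewrite !andbF !mulr0 !mul0r.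
rewrite !mulr1 andbT.
have rmorphV (x : R) : (x^-1)%:C = (x%:C)^-1 :> R[i] by exact: fmorphV.
have real_nat n : (n%:R)%:C = n%:R :> R[i] by exact: (rmorph_nat (real_complex R)).
rewrite (wigner_d_grid_orthogonal R B_gt0) //; try by move: pp qq; rewrite /lbl; lia.
case: eqVneq => _ /=; last by rewrite mulr0 mul0r.
rewrite mul1r -[in RHS]real_nat -rmorphV -[B.*2%:R]real_nat -!realM; congr _%:C.
have: l.*2.+1%:R != 0 :> R by rewrite pnatr_eq0.
by rewrite -[B.*2]mul2n natrM; move: l.*2.+1%:R => r r0; field; rewrite r0 B0.
Qed.

(** The entries of [cplx_harmonic] are real, so taking real parts loses nothing. *)
Lemma harmonic_UE l (Q : 'M[R]_3) m n : (harmonic_U l Q m n)%:C =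
  \sum_(q < l.*2.+1) \sum_(p < l.*2.+1)
    conjc (real_basis R l m p) * real_basis R l n q * wigner_D l Q p q.
Proof.
transitivity (cplx_harmonic l Q m n).
  by rewrite mxE; apply/eqP; rewrite eq_complex /= cplx_harmonic_real !eqxx.
rewrite mxE; apply: eq_bigr => q _; rewrite mxE mulr_suml; apply: eq_bigr => p _.
by rewrite !mxE; ring.
Qed.

Lemma grid_angle_itv j : (j < B.*2)%N -> 0 <= grid_angle R B j < 2 * pi.
Proof.
move=> jB; have p0 := pi_gt0 R; have B0 : 0 < B%:R :> R by rewrite ltr0n.
rewrite /grid_angle; apply/andP; split.
  by rewrite mulr_ge0 ?divr_ge0 ?(ltW p0) ?(ltW B0).
rewrite mulrAC ltr_pdivrMr// (mulrC 2) -mulrA ltr_pM2l// -natrM ltr_nat.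
by rewrite mul2n.
Qed.

(** Since the harmonics are real, one factor may be conjugated; this gives the
    sesquilinear sums of [wigner_grid_orthogonal], and unitarity of [real_basis]
    carries their orthogonality over to the real harmonics. *)
Lemma harmonic_grid_orthogonal l l' (m n : 'I_(l.*2.+1)) (m' n' : 'I_(l'.*2.+1)) :
  (l < B)%N -> (l' < B)%N ->
  \sum_(j1 < B.*2) \sum_(j2 < B.*2) \sum_(k < B.*2) grid_weight R B k *
    (harmonic_U l (euler (grid_angle R B j1) (grid_beta R B k) (grid_angle R B j2)) m n *
     harmonic_U l' (euler (grid_angle R B j1) (grid_beta R B k) (grid_angle R B j2)) m' n')
  = ((l == l') && ((lbl m == lbl m') && (lbl n == lbl n')))%:R / (l.*2.+1)%:R.
Proof.
move=> lB lB'; apply: (@complexI R).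
pose T := real_basis R l; pose T' := real_basis R l'.
transitivity (grid_sum (fun x y z => (harmonic_U l (euler x y z) m n)%:C *
    (harmonic_U l' (euler x y z) m' n')%:C)).
  rewrite rmorph_sum; apply: eq_bigr => j1 _; rewrite rmorph_sum; apply: eq_bigr => j2 _.
  by rewrite rmorph_sum; apply: eq_bigr => k _; rewrite /= !realM.
transitivity (\sum_q \sum_p \sum_q' \sum_p'
  (T m p * conjc (T n q) * (conjc (T' m' p') * T' n' q')) *
  (((l == l') && ((lbl p == lbl p') && (lbl q == lbl q')))%:R / (l.*2.+1)%:R)).
  transitivity (grid_sum (fun x y z => \sum_q \sum_p \sum_q' \sum_p'
    (T m p * conjc (T n q) * (conjc (T' m' p') * T' n' q')) *
    (conjc (wigner_euler l x y z p q) * wigner_euler l' x y z p' q'))).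
    apply: eq_grid_sum => j1 j2 k j1B j2B kB; set Q := euler _ _ _.
    have WE r : wigner_D r Q = wigner_euler r (grid_angle R B j1) (grid_beta R B k)
        (grid_angle R B j2).
      by apply: wigner_D_euler; [exact: grid_angle_itv | exact: grid_beta_itv
        | exact: grid_angle_itv].
    rewrite -[X in X * _ = _]conjc_real !harmonic_UE -!WE rmorph_sum mulr_suml.
    apply: eq_bigr => q _; rewrite rmorph_sum mulr_suml; apply: eq_bigr => p _.
    rewrite mulr_sumr; apply: eq_bigr => q' _; rewrite mulr_sumr; apply: eq_bigr => p' _.
    by rewrite /= !conjM conjcK; ring.
  rewrite grid_sum_sum; apply: eq_bigr => q _; rewrite grid_sum_sum; apply: eq_bigr => p _.
  rewrite grid_sum_sum; apply: eq_bigr => q' _; rewrite grid_sum_sum; apply: eq_bigr => p' _.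
  by rewrite grid_sumZ wigner_grid_orthogonal.
case: (eqVneq l l') => [ll|ll] /=; last first.
  rewrite [RHS](_ : _ = 0) ?mul0r // big1 // => q _; rewrite big1 // => p _.
  by rewrite big1 // => q' _; rewrite big1 // => p' _; rewrite mulr0.
subst l'; rewrite !lbl_eq.
transitivity ((\sum_p T m p * conjc (T m' p)) * (\sum_q T n' q * conjc (T n q))
    / (l.*2.+1)%:R).
  rewrite mulrAC mulr_sumr; apply: eq_bigr => q _; rewrite mulrAC mulr_suml mulr_suml.
  apply: eq_bigr => p _; rewrite (bigD1 q) //= [X in _ + X]big1 ?addr0 => [|q' qq].
    rewrite (bigD1 p) //= [X in _ + X]big1 ?addr0 => [|p' pp]; rewrite !lbl_eq.
      by rewrite !eqxx /= mulr1n; ring.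
    by rewrite eq_sym (negbTE pp) mul0r mulr0.
  by rewrite big1 // => p' _; rewrite !lbl_eq [q == _]eq_sym (negbTE qq) andbF mul0r mulr0.
rewrite !real_basis_unitary [n' == n]eq_sym.
rewrite [RHS](rmorphM (real_complex R)) /= fmorphV !(rmorph_nat (real_complex R)).
by rewrite -natrM mulnb.
Qed.

End GridFunctional.

Theorem theorem2 (R : realType) (B : nat) (hB : (1 <= B)%N)
    (F : forall l : nat, 'M[R]_(l.*2.+1)) (f : 'M[R]_3 -> R)
    (hf : harmonic_expansion F f)
    (hband : forall l : nat, (B <= l)%N -> F l = 0)
    (l : nat) (hl : (l < B)%N) (m n : 'I_(l.*2.+1)) :
  F l m n =
    \sum_(j1 < B.*2) \sum_(j2 < B.*2) \sum_(k < B.*2)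
      grid_weight R B k
      * harmonic_U l (euler (grid_angle R B j1) (grid_beta R B k)
                            (grid_angle R B j2)) m n
      * f (euler (grid_angle R B j1) (grid_beta R B k) (grid_angle R B j2)).
Proof.
have fE a b g : f (euler a b g) = \sum_(l' < B) \sum_m' \sum_n'
    (l'.*2.+1)%:R * F l' m' n' * harmonic_U l' (euler a b g) m' n'.
  have lim := hf _ (euler_SO3 a b g).
  (* Band-limitation makes the partial sums constant from [B] on. *)
  apply: (cvg_unique (@norm_hausdorff _ _) lim); apply: cvg_near_cst.
  exists B => // N /= BN; rewrite /series /= (big_cat_nat _ BN) //= big_mkord.
  rewrite [X in _ + X]big_nat_cond [X in _ + X]big1 ?addr0 // => l' /andP[/andP[Bl _] _].
  by rewrite big1 // => p _; rewrite big1 // => q _; rewrite hband // mxE mulr0 mul0r.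
under eq_bigr do under eq_bigr do under eq_bigr do rewrite fE.
transitivity (\sum_(l' < B) \sum_m' \sum_n' (l'.*2.+1)%:R * F l' m' n' *
    (((l == l') && ((lbl m == lbl m') && (lbl n == lbl n')))%:R / (l.*2.+1)%:R)).
  rewrite (bigD1 (Ordinal hl)) //= [X in _ = _ + X]big1 ?addr0 => [|l' ll].
    rewrite (bigD1 m) //= [X in _ = _ + X]big1 ?addr0 => [|p pm].
      rewrite (bigD1 n) //= [X in _ = _ + X]big1 ?addr0 => [|q qn].
        by rewrite !eqxx /= mul1r mulrAC mulfV ?mul1r // pnatr_eq0.
      by rewrite [lbl n == _]eq_sym (lbl_eq q n) (negbTE qn) !andbF mul0r mulr0.
    rewrite big1 // => q _.
    by rewrite [lbl m == _]eq_sym (lbl_eq p m) (negbTE pm) andbF mul0r mulr0.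
  rewrite big1 // => p _; rewrite big1 // => q _.
  by rewrite (_ : (l == l') = false) ?mul0r ?mulr0 //; apply/negbTE; rewrite eq_sym.
symmetry; under [LHS]eq_bigr do under eq_bigr do under eq_bigr do rewrite mulr_sumr.
rewrite exchange_big_triple; apply: eq_bigr => -[l' l'B] _ /=.
under [LHS]eq_bigr do under eq_bigr do under eq_bigr do rewrite mulr_sumr.
rewrite exchange_big_triple; apply: eq_bigr => m' _.
under [LHS]eq_bigr do under eq_bigr do under eq_bigr do rewrite mulr_sumr.
rewrite exchange_big_triple; apply: eq_bigr => n' _.
rewrite -(harmonic_grid_orthogonal R hB) // mulr_sumr; apply: eq_bigr => j1 _.
rewrite mulr_sumr; apply: eq_bigr => j2 _; rewrite mulr_sumr; apply: eq_bigr => k _.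
ring.
Qed.
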